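(* Let $Q=(q_{ij})_{i,j\in E}$ be an irreducible regular $Q$-matrix on a countable state space $E$ and let $H$ be a non-empty finite subset of $E$. Then the $Q$-process is non-strongly ergodic if and only if there is a sequence $\{y^{(n)}\}_{n=1}^{\infty}$ of real-valued functions $y^{(n)}=(y^{(n)}_i)_{i\notin H}$ on $E\setminus H$ satisfying the following conditions: (1) for each $n\ge 1$, $\sup_{i\notin H} y^{(n)}_i<\infty$ and $y=y^{(n)}$ solves the inequality $$y_i\le \sum_{j\notin H}\Pi_{ij}\,y_j+\frac{1}{q_i},\qquad i\notin H;$$ (2) $\sup_{n\ge 1}\sup_{i\notin H} y^{(n)}_i=\infty$ (or equivalently, $\varlimsup_{n\to\infty}\sup_{i\notin H}y^{(n)}_i=\infty$).
   Context: A $Q$-matrix on a countable set $E$ has $q_{ij}\ge 0$ for $i\ne j$ and $q_i:=-q_{ii}=\sum_{j\ne i}q_{ij}<\infty$. It is regular if the associated continuous-time Markov chain (the $Q$-process) $(X_t)_{t\ge0}$ with transition probabilities $p_{ij}(t)$ is unique (non-explosive). The embedding chain is $\Pi=(\Pi_{ij})$, $\Pi_{ij}=q_{ij}/q_i$ for $j\neq i$ and $\Pi_{ii}=0$. The $Q$-process is strongly ergodic if, with $\pi$ its stationary probability distribution, $\lim_{t\to\infty}\sup_{i\in E}\sum_{j\in E}|p_{ij}(t)-\pi_j|=0$. Known equivalent description: with $\eta_1$ the first jump time and $\sigma_H=\inf\{t\ge\eta_1: X_t\in H\}$, the process is strongly ergodic iff $(\mathbf{E}_i\sigma_H)_{i\notin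 H}$ is bounded for some (equivalently, any) non-empty finite $H\subseteq E$. The functions $y^{(n)}$ are finite-valued but need not be non-negative nor bounded below. *)

(* Defs.v *)
(* MathComp world (MathComp-Analysis). *)
From HB Require Import structures.
From mathcomp Require Import all_boot all_order all_algebra.
From mathcomp Require Import all_classical all_reals all_analysis.

Set Implicit Arguments.
Unset Strict Implicit.
Unset Printing Implicit Defensive.

Import Order.TTheory GRing.Theory Num.Theory.
Import numFieldNormedType.Exports.

Local Open Scope classical_set_scope.
Local Open Scope ring_scope.

Section QProcesses.
Context {R : realType} {E : countType}.
Implicit Types (Q : E -> E -> R) (P : R -> E -> E -> R).

(* The rate q_i = - q_ii of leaving i. *)
Definition exit_rate Q (i : E) : R := - Q i i.

Definition is_Qmatrix Q : Prop :=
  (forall i j, i != j -> 0 <= Q i j) /\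
  (forall i, \esum_(j in [set j | j != i]) (Q i j)%:E = (exit_rate Q i)%:E).

(* Diagonal entries are nonpositive, so every step of the path is a jump. *)
Definition irreducible Q : Prop :=
  forall i j, exists s : seq E,
    path (fun a b => 0 < Q a b) i s /\ last i s = j.

Definition embedding_chain Q (i j : E) : R :=
  if j == i then 0 else Q i j / exit_rate Q i.

(* Standard transition functions (P t i j is p_ij(t)), possibly
   substochastic; only the values of P at times t >= 0 are meaningful. *)
Record is_transition_function P : Prop := {
  tf_ge0 : forall (t : R) i j, 0 <= t -> 0 <= P t i j;
  tf_sum_le1 : forall (t : R) i, 0 <= t ->
    (\esum_(j in [set: E]) (P t i j)%:E <= 1)%E;
  tf_0 : forall i j, P 0 i j = (i == j)%:R;
  tf_chapman_kolmogorov : forall (s t : R) i j, 0 <= s -> 0 <= t ->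
    (P (s + t) i j)%:E = \esum_(k in [set: E]) (P s i k * P t k j)%:E;
  tf_standard : forall i j, P t i j @[t --> 0^'+] --> ((i == j)%:R : R)
}.

Definition is_Qprocess Q P : Prop :=
  is_transition_function P /\
  forall i j, (P t i j - (i == j)%:R) / t @[t --> 0^'+] --> Q i j.

(* No mass is lost in finite time. *)
Definition non_explosive P : Prop :=
  forall t i, 0 <= t -> (\esum_(j in [set: E]) (P t i j)%:E = 1)%E.

(* Uniqueness is among all, possibly substochastic, Q-processes; the unique
   one is then the minimal process, and non-explosion says that it is
   stochastic. *)
Definition regular Q : Prop :=
  exists P, [/\ is_Qprocess Q P, non_explosive P &
    forall P', is_Qprocess Q P' ->
      forall t i j, 0 <= t -> P' t i j = P t i j].

Definition is_stationary_distribution P (pi : E -> R) : Prop :=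
  [/\ forall i, 0 <= pi i,
      (\esum_(i in [set: E]) (pi i)%:E = 1)%E &
      forall t j, 0 <= t ->
        \esum_(i in [set: E]) (pi i * P t i j)%:E = (pi j)%:E].

Definition strongly_ergodic P : Prop :=
  exists2 pi : E -> R, is_stationary_distribution P pi &
    ereal_sup [set \esum_(j in [set: E]) `|P t i j - pi j|%:E | i in [set: E]]
      @[t --> +oo%R] --> 0%E.

(* The sum over D of a function of arbitrary sign, as the sum of its positive
   part minus the sum of its negative part. It is the intended value, possibly
   -oo, as soon as the first of these two is finite. *)
Definition signed_esum (D : set E) (f : E -> R) : \bar R :=
  (\esum_(j in D) (Num.max (f j) 0)%:E
   - \esum_(j in D) (Num.max (- f j) 0)%:E)%E.

(* Functions on the complement of H are represented by functions on E whose
   values on H are never used. *)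
Definition sup_outside (H : set E) (y : E -> R) : \bar R :=
  ereal_sup [set (y i)%:E | i in ~` H].

(* As sup_outside H y < +oo and the rows of the embedding chain have sum at
   most 1, the positive part of the sum is finite. A sum equal to -oo violates
   the inequality. *)
Definition bounded_above_subsolution Q (H : set E) (y : E -> R) : Prop :=
  (sup_outside H y < +oo)%E /\
  forall i, ~ H i ->
    ((y i)%:E <= signed_esum (~` H) (fun j => embedding_chain Q i j * y j)%R
                 + ((exit_rate Q i)^-1)%:E)%E.

End QProcesses.

(* Main.v *)
Require Import Defs.
From HB Require Import structures.
From mathcomp Require Import all_boot all_order all_algebra.
From mathcomp Require Import finmap ring lra.
From mathcomp Require Import all_classical all_reals all_analysis.

Set Implicit Arguments.
Unset Strict Implicit.
Unset Printing Implicit Defensive.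

Import Order.TTheory GRing.Theory Num.Theory.
Import numFieldNormedType.Exports.

Local Open Scope classical_set_scope.
Local Open Scope ring_scope.

(* The minimal transition function is built as the supremum, over subdivisions
   (h_1, ..., h_n) of t, of the products of sub-Markov kernels bounding from
   below the event "at most one jump during h_k". The kernels are
   superadditive in h, so refining a subdivision increases the product; hence
   the supremum satisfies Chapman-Kolmogorov, is a Q-process, and by
   regularity is P and loses no mass. Every inequality about P then reduces to
   one about a single kernel.

   If the chain is strongly ergodic and y is a subsolution bounded above,
   extend z = max(y, 0) by 0 on H. Then Qz >= -1 everywhere, whence
   z <= t + P_t z. As z vanishes at some j in H and p_ij(t) >= e for all i,
   sup z <= t + (1 - e) sup z, a bound independent of y.

   Conversely, iterating the equation from 0 with a truncated source term gives
   bounded subsolutions. If they were uniformly bounded, their limit m would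
   satisfy Qm <= -1 off H; comparing t + m with the occupation time of H gives
   a uniform lower bound for p_ij(t) for some t and j, and Doeblin's contraction
   argument yields strong ergodicity. *)

(** * Sums over countable sets *)

Section esum_extra.
Context {R : realType} {T : choiceType}.
Implicit Types (D : set T) (f g : T -> \bar R) (s : seq T).
Local Open Scope ereal_scope.

Lemma esum_le_seq D f (u : \bar R) :
  (forall s, uniq s -> (forall j, j \in s -> D j) -> \sum_(j <- s) f j <= u) ->
  \esum_(j in D) f j <= u.
Proof.
move=> fu; apply: ge_ereal_sup => _ [X [finX XD] <-].
rewrite fsbig_finite//; apply: fu => [|j]; first exact: fset_uniq.
by rewrite in_fset_set// => /set_mem/XD.
Qed.

Lemma seq_le_esum D f s : (forall j, D j -> 0 <= f j) -> uniq s ->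
  (forall j, j \in s -> D j) -> \sum_(j <- s) f j <= \esum_(j in D) f j.
Proof.
move=> f0 us sD; apply: esum_ge; exists [set` s].
  by split => //; exact: finite_seq.
by rewrite fsbig_seq.
Qed.

Lemma esum_ge1 D f j : (forall k, D k -> 0 <= f k) -> D j ->
  f j <= \esum_(k in D) f k.
Proof.
move=> f0 Dj; have := @seq_le_esum D f [:: j] f0 isT.
by rewrite big_seq1; apply => k; rewrite inE => /eqP ->.
Qed.

Lemma esum_gt_seq D f (u : \bar R) : u < \esum_(j in D) f j ->
  exists s, [/\ uniq s, forall j, j \in s -> D j & u < \sum_(j <- s) f j].
Proof.
move=> /ereal_sup_gt[_ [X [finX XD] <-]] uX; exists (fset_set X); split.
- exact: fset_uniq.
- by move=> j; rewrite in_fset_set// => /set_mem/XD.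
- by rewrite -fsbig_finite.
Qed.

Lemma ge0_esumZl D f (c : R) : (0 <= c)%R -> (forall j, D j -> 0 <= f j) ->
  \esum_(j in D) (c%:E * f j) = c%:E * \esum_(j in D) f j.
Proof.
have le (a : R) h : (0 <= a)%R -> (forall j, D j -> 0 <= h j) ->
    \esum_(j in D) (a%:E * h j) <= a%:E * \esum_(j in D) h j.
  move=> a0 h0; apply: esum_le_seq => s us sD.
  rewrite big_seq -ge0_sume_distrr; last by move=> j /sD/h0.
  by rewrite -big_seq lee_wpmul2l// seq_le_esum.
move=> c0 f0; apply/eqP; rewrite eq_le le//=.
have [->|cN0] := eqVneq c 0%R.
  by rewrite mul0e esum_ge0// => j _; rewrite mul0e.
have {cN0}c0 : (0 < c)%R by rewrite lt_neqAle eq_sym cN0.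
have cf0 j : D j -> 0 <= c%:E * f j.
  by move=> Dj; rewrite mule_ge0 ?lee_fin ?(ltW c0)//; exact: f0.
have cV0 : (0 <= c^-1)%R by rewrite invr_ge0 ltW.
have cV := le c^-1%R _ cV0 cf0.
rewrite -lee_pdivlMl//; apply: le_trans cV; apply: le_esum => j Dj.
by rewrite muleA -EFinM mulVf ?mul1e// gt_eqF.
Qed.

Lemma esumD1 f i : (forall j, 0 <= f j) ->
  \esum_(j in [set: T]) f j = f i + \esum_(j in [set j | j != i]) f j.
Proof.
move=> f0; rewrite (esumID [set i])//; congr (_ + _).
  by rewrite setTI esum_set1.
congr (esum _ _); rewrite setTI; apply/seteqP; split=> j /=.
  by move=> ji; apply/eqP.
by move=> /eqP.
Qed.

(** Monotone convergence for directed families: a partial sum sees finitely many indices, and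
    directedness yields one member of the family close to [G] at all of them. *)
Lemma esum_le_directed (I : Type) (D : set I) (g : I -> T -> R) (c G : T -> R)
    (u : \bar R) :
  D !=set0 -> (forall j, 0 <= c j)%R ->
  (forall x y, D x -> D y ->
    exists2 z, D z & forall j, (g x j <= g z j)%R /\ (g y j <= g z j)%R) ->
  (forall j e, (0 < e)%R -> exists2 x, D x & (G j <= g x j + e)%R) ->
  (forall x j, D x -> 0 <= g x j)%R ->
  (forall x, D x -> \esum_(j in [set: T]) (c j * g x j)%:E <= u) ->
  \esum_(j in [set: T]) (c j * G j)%:E <= u.
Proof.
move=> [x0 Dx0] c0 dir adh g0 gu; apply: esum_le_seq => s us _.
apply/lee_addgt0Pr => e e0.
have unif d : (0 < d)%R -> exists2 x, D x &
    forall j, j \in s -> (G j <= g x j + d)%R.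
  move=> d0; elim: {us} s => [|j s [x Dx xs]]; first by exists x0.
  have [y Dy yj] := adh j _ d0.
  have [z Dz xyz] := dir _ _ Dx Dy; exists z => // k; rewrite inE.
  case/predU1P => [->|/xs ks].
    by apply: (le_trans yj); rewrite lerD2r (xyz j).2.
  by apply: (le_trans ks); rewrite lerD2r (xyz k).1.
pose C := (\sum_(j <- s) c j)%R.
have C0 : (0 <= C)%R by apply: sumr_ge0 => j _.
(* With this error per index the weighted errors add up to at most [e]; the [+ 1] covers [C = 0]. *)
have d0 : (0 < e / (C + 1))%R by rewrite divr_gt0// ltr_pwDr.
have [x Dx xs] := unif _ d0.
apply: (@le_trans _ _ (\sum_(j <- s) (c j * g x j)%:E + e%:E)); last first.
  rewrite leeD2r//; apply: le_trans (gu x Dx); apply: seq_le_esum => // j _.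
  by rewrite lee_fin mulr_ge0// g0.
rewrite !sumEFin -EFinD lee_fin.
apply: (@le_trans _ _ (\sum_(j <- s) (c j * g x j + c j * (e / (C + 1))))%R).
  by rewrite !big_seq; apply: ler_sum => j /xs js; rewrite -mulrDr ler_wpM2l.
rewrite big_split/= lerD2l -mulr_suml -/C mulrA ler_pdivrMr ?ltr_pwDr//.
by rewrite mulrC ler_wpM2l// ?lerDl// ltW.
Qed.

End esum_extra.

Lemma esum_exchange (R : realType) (T T' : choiceType) (D : set T)
    (D' : set T') (f : T -> T' -> \bar R) :
  (forall i j, D i -> D' j -> 0 <= f i j)%E ->
  (\esum_(i in D) \esum_(j in D') f i j =
   \esum_(j in D') \esum_(i in D) f i j)%E.
Proof.
have le (S1 S2 : choiceType) (D1 : set S1) (D2 : set S2)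
    (h : S1 -> S2 -> \bar R) :
    (forall i j, D1 i -> D2 j -> 0 <= h i j)%E ->
    (\esum_(i in D1) \esum_(j in D2) h i j <=
     \esum_(j in D2) \esum_(i in D1) h i j)%E.
  move=> h0; apply: esum_le_seq => s us sD.
  rewrite big_seq -esum_sum; last by move=> i j D2i /sD D1j; exact: h0.
  apply: le_esum => j D2j; rewrite -big_seq; apply: seq_le_esum => // i D1i.
  exact: h0.
by move=> f0; apply/eqP; rewrite eq_le !le// => i j Di Dj; exact: f0.
Qed.

(** * One-jump kernels and their products *)

Section steps.
Context {R : realType} {E : countType} (Q : E -> E -> R).
Implicit Types (h s t : R) (i j k : E) (f g : E -> \bar R) (w : E -> R)
  (L : seq R).

Let q := exit_rate Q.

(** A lower bound for the holding probability exp(- h q_i), cut off at 0 to stay non-negative for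
    large [h]. *)
Definition stay h i : R := Num.max 0 (1 - h * q i).

(* A lower bound for the probability of exactly one jump, from i to j, during
   a time h; its product form makes step superadditive in h. *)
Definition jump h i j : R := h * Q i j * (stay h i * stay h j).

Definition step h f i : \bar R :=
  ((stay h i)%:E * f i + \esum_(j in [set j | j != i]) (jump h i j)%:E * f j)%E.

Definition steps L f : E -> \bar R := foldr step f L.

Definition indic_at k j : \bar R := ((j == k)%:R : R)%:E.

Definition subdivision t : set (seq R) :=
  [set L | all (fun h => 0 <= h) L /\ \sum_(h <- L) h = t].

(** For [t >= 0] the supremum lies in [0, 1], so [fine] loses nothing; for [t < 0] there is no
    subdivision and the value is 0. *)
Definition min_prob t i j : R :=
  fine (ereal_sup [set steps L (indic_at j) i | L in subdivision t]).

Lemma stay_ge0 h i : 0 <= stay h i.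
Proof. by rewrite /stay le_max lexx. Qed.

Lemma stay_ge h i : 1 - h * q i <= stay h i.
Proof. by rewrite /stay le_max lexx orbT. Qed.

Lemma indic_at_ge0 k j : (0 <= indic_at k j)%E.
Proof. by rewrite /indic_at lee_fin ler0n. Qed.

Lemma subdivision_cat s t L1 L2 : subdivision s L1 -> subdivision t L2 ->
  subdivision (s + t) (L1 ++ L2).
Proof. by move=> [p1 <-] [p2 <-]; split; rewrite ?all_cat ?p1 ?p2// big_cat. Qed.

Lemma subdivision1 t : 0 <= t -> subdivision t [:: t].
Proof. by move=> t0; split; rewrite /= ?t0// big_seq1. Qed.

Lemma subdivision_cons h t L :
  subdivision t (h :: L) <-> 0 <= h /\ subdivision (t - h) L.
Proof.
rewrite /subdivision /= big_cons; split=> [[/andP[-> ->] <-]|[-> [-> ->]]].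
  by rewrite addrC addKr.
by rewrite addrC subrK.
Qed.

Lemma subdivision_ge0 t L : subdivision t L -> 0 <= t.
Proof.
move=> [L0 <-]; rewrite big_seq; apply: sumr_ge0 => h hL.
by move/allP : L0; apply.
Qed.

Context (Q_matrix : is_Qmatrix Q).

Lemma Qmatrix_ge0 i j : j != i -> 0 <= Q i j.
Proof. by rewrite eq_sym; exact: Q_matrix.1. Qed.

Lemma exit_rate_ge0 i : 0 <= q i.
Proof.
rewrite -lee_fin -Q_matrix.2 esum_ge0// => j /= ji.
by rewrite lee_fin Qmatrix_ge0.
Qed.

Lemma jump_ge0 h i j : 0 <= h -> j != i -> 0 <= jump h i j.
Proof. by move=> h0 ji; rewrite !mulr_ge0 ?stay_ge0 ?Qmatrix_ge0. Qed.

Lemma stay_le1 h i : 0 <= h -> stay h i <= 1.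
Proof.
by move=> h0; rewrite /stay ge_max ler01 gerBl mulr_ge0 ?exit_rate_ge0.
Qed.

Lemma stay0 i : stay 0 i = 1.
Proof. by rewrite /stay mul0r subr0; apply/max_idPr; exact: ler01. Qed.

(** With a = s q_i and b = t q_i, either (1 - a)(1 - b) >= 1 - (a + b) applies, or one of a, b
    exceeds 1 and 1 - (a + b) is negative. *)
Lemma stayD s t i : 0 <= s -> 0 <= t -> stay (s + t) i <= stay s i * stay t i.
Proof.
move=> s0 t0; rewrite {1}/stay ge_max mulr_ge0 ?stay_ge0//=.
have [st|st] := leP (s * q i) 1; have [tt|tt] := leP (t * q i) 1.
- apply: le_trans (_ : _ <= (1 - s * q i) * (1 - t * q i)) _.
    have := mulr_ge0 (mulr_ge0 s0 (exit_rate_ge0 i)) (mulr_ge0 t0 (exit_rate_ge0 i)).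
    nra.
  by apply: ler_pM; rewrite ?subr_ge0 ?stay_ge.
- apply: le_trans (mulr_ge0 (stay_ge0 _ _) (stay_ge0 _ _)).
  by have := mulr_ge0 s0 (exit_rate_ge0 i); nra.
- apply: le_trans (mulr_ge0 (stay_ge0 _ _) (stay_ge0 _ _)).
  by have := mulr_ge0 t0 (exit_rate_ge0 i); nra.
- apply: le_trans (mulr_ge0 (stay_ge0 _ _) (stay_ge0 _ _)).
  by have := mulr_ge0 t0 (exit_rate_ge0 i); nra.
Qed.

Lemma step_ge0 h f : 0 <= h -> (forall j, 0 <= f j)%E ->
  forall i, (0 <= step h f i)%E.
Proof.
move=> h0 f0 i; rewrite /step adde_ge0// ?mule_ge0 ?lee_fin ?stay_ge0//.
by apply: esum_ge0 => j ji; rewrite mule_ge0 ?lee_fin ?jump_ge0.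
Qed.

Lemma le_step h f g : 0 <= h -> (forall j, f j <= g j)%E ->
  forall i, (step h f i <= step h g i)%E.
Proof.
move=> h0 fg i; rewrite /step leeD ?lee_wpmul2l ?lee_fin ?stay_ge0//.
by apply: le_esum => j ji; rewrite lee_wpmul2l ?lee_fin ?jump_ge0.
Qed.

Lemma step0 f : (forall j, 0 <= f j)%E -> step 0 f = f.
Proof.
move=> f0; apply/funext => i; rewrite /step stay0 mul1e esum1 ?adde0//.
by move=> j _; rewrite /jump !mul0r mul0e.
Qed.

Lemma stepZ_add h (a : R) f g : 0 <= h -> 0 <= a ->
  (forall j, 0 <= f j)%E -> (forall j, 0 <= g j)%E ->
  forall i, step h (fun j => f j + a%:E * g j)%E i =
    (step h f i + a%:E * step h g i)%E.
Proof.
move=> h0 a0 f0 g0 i; rewrite /step.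
have e0 := stay_ge0 h i; have ag0 j : (0 <= a%:E * g j)%E by rewrite mule_ge0.
under eq_esum => j ji do
  rewrite (ge0_muleDr _ (f0 j) (ag0 j)) muleCA.
rewrite esumD; last 2 first.
- by move=> j ji; rewrite mule_ge0 ?lee_fin ?jump_ge0.
- by move=> j ji; rewrite !mule_ge0 ?lee_fin ?jump_ge0.
have Jg0 j : j != i -> (0 <= (jump h i j)%:E * g j)%E.
  by move=> ji; rewrite mule_ge0 ?lee_fin ?jump_ge0.
rewrite ge0_esumZl// ge0_muleDr// (muleCA (stay h i)%:E).
rewrite [in RHS]ge0_muleDr ?mule_ge0 ?esum_ge0//.
by rewrite -!addeA; congr (_ + _)%E; rewrite addeCA.
Qed.

(** A single jump falls either in the first interval or in the second, and two successive steps
    account for both cases. *)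
Lemma step_superadditive s t f : 0 <= s -> 0 <= t -> (forall j, 0 <= f j)%E ->
  forall i, (step (s + t) f i <= step s (step t f) i)%E.
Proof.
move=> s0 t0 f0 i.
have J0 h j : 0 <= h -> j != i -> (0 <= (jump h i j)%:E * f j)%E.
  by move=> h0 ji; rewrite mule_ge0 ?lee_fin ?jump_ge0.
(* The intermediate term leaves out the paths that jump in both intervals. *)
apply: (@le_trans _ _ ((stay s i)%:E * step t f i +
    \esum_(j in [set j | j != i]) (jump s i j)%:E * ((stay t j)%:E * f j))%E).
  rewrite /step ge0_muleDr; first last.
  - by apply: esum_ge0 => j; exact: J0.
  - by rewrite mule_ge0 ?lee_fin ?stay_ge0.
  rewrite -ge0_esumZl; first last.
  - by move=> j; exact: J0.
  - exact: stay_ge0.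
  rewrite -addeA -esumD; first last.
  - by move=> j ji; rewrite !mule_ge0 ?lee_fin ?jump_ge0 ?stay_ge0.
  - by move=> j ji; rewrite !mule_ge0 ?lee_fin ?jump_ge0 ?stay_ge0.
  apply: leeD; first by rewrite muleA -EFinM lee_wpmul2r// lee_fin stayD.
  apply: le_esum => j ji; rewrite !muleA -!EFinM -ge0_muleDl; first last.
  - by rewrite lee_fin mulr_ge0 ?stay_ge0 ?jump_ge0.
  - by rewrite lee_fin mulr_ge0 ?stay_ge0 ?jump_ge0.
  rewrite lee_wpmul2r// -EFinD lee_fin /jump.
  have Q0 := Qmatrix_ge0 ji.
  have [a0 b0 c0 d0] : [/\ 0 <= stay s i, 0 <= stay t i, 0 <= stay s j &
    0 <= stay t j] by split; exact: stay_ge0.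
  have [a1 b1 c1 d1] : [/\ stay s i <= 1, stay t i <= 1, stay s j <= 1 &
    stay t j <= 1] by split; exact: stay_le1.
  have st_i := stayD i s0 t0; have st_j := stayD j s0 t0.
  have le : stay (s + t) i * stay (s + t) j <=
      (stay s i * stay t i) * (stay s j * stay t j).
    by apply: ler_pM; rewrite ?stay_ge0.
  have le1 : (stay s i * stay t i) * (stay s j * stay t j) <=
      stay s i * (stay t i * stay t j).
    rewrite -mulrA ler_wpM2l// ler_wpM2l// ler_piMl//.
  have le2 : (stay s i * stay t i) * (stay s j * stay t j) <=
      stay s i * stay s j * stay t j.
    rewrite mulrACA ler_wpM2l ?mulr_ge0// ler_piMl//.
  rewrite mulrDl [in leLHS]mulrDl addrC; apply: lerD.
    by rewrite [leRHS]mulrCA ler_wpM2l ?mulr_ge0//; exact: le_trans le1.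
  by rewrite -(mulrA (s * Q i j)) ler_wpM2l ?mulr_ge0//; exact: le_trans le2.
rewrite {2}/step leeD2l//; apply: le_esum => j ji.
rewrite lee_wpmul2l ?lee_fin ?jump_ge0// /step leeDl//.
by apply: esum_ge0 => k kj; rewrite mule_ge0 ?lee_fin ?jump_ge0.
Qed.

Lemma step_le_drift h w i (c : R) : 0 <= h -> (forall j, 0 <= w j) ->
  (\esum_(j in [set j | j != i]) (Q i j * w j)%:E <= c%:E)%E ->
  (step h (EFin \o w) i <= (stay h i * (w i + h * c))%:E)%E.
Proof.
move=> h0 w0 Qw; rewrite mulrDr EFinD /step /= -EFinM leeD2l//.
have Qw0 j : j != i -> (0 <= (Q i j * w j)%:E)%E.
  by move=> ji; rewrite lee_fin mulr_ge0 ?Qmatrix_ge0.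
apply: (@le_trans _ _ (\esum_(j in [set j | j != i])
    (stay h i * h)%:E * (Q i j * w j)%:E)%E).
  apply: le_esum => j ji; rewrite -!EFinM lee_fin /jump.
  rewrite [leRHS](_ : _ = h * Q i j * stay h i * w j); last by ring.
  rewrite ler_wpM2r// mulrA ler_piMr ?stay_le1// !mulr_ge0 ?stay_ge0//.
  exact: Qmatrix_ge0.
rewrite ge0_esumZl ?mulr_ge0 ?stay_ge0//.
by rewrite [in leRHS]mulrA [in leRHS]EFinM lee_wpmul2l ?lee_fin ?mulr_ge0 ?stay_ge0.
Qed.

(** The kernel is sub-Markov because (1 - h q_i)(1 + h q_i) <= 1. *)
Lemma step_const_le h (c : R) i : 0 <= h -> 0 <= c ->
  (step h (fun=> c%:E) i <= c%:E)%E.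
Proof.
move=> h0 c0; have /= := @step_le_drift h (fun=> c) i (q i * c) h0 (fun=> c0).
have Qc : (\esum_(j in [set j | j != i]) (Q i j * c)%:E <= (q i * c)%:E)%E.
  under eq_esum => j ji do rewrite mulrC EFinM.
  rewrite ge0_esumZl ?Q_matrix.2 -?EFinM 1?mulrC// => j ji.
  by rewrite lee_fin Qmatrix_ge0.
move=> /(_ Qc) /le_trans; apply; rewrite lee_fin.
have q0 := exit_rate_ge0 i; rewrite /stay.
have hq : 0 <= h * q i by rewrite mulr_ge0.
have chq := mulr_ge0 c0 (mulr_ge0 hq hq).
by case: (leP 0 (1 - h * q i)) => hq1; nra.
Qed.

Lemma steps_ge0 L f : all (fun h => 0 <= h) L -> (forall j, 0 <= f j)%E ->
  forall i, (0 <= steps L f i)%E.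
Proof. by elim: L => //= h L IH /andP[h0 /IH{}IH] /IH; exact: step_ge0. Qed.

Lemma le_steps L f g : all (fun h => 0 <= h) L -> (forall j, f j <= g j)%E ->
  forall i, (steps L f i <= steps L g i)%E.
Proof. by elim: L => //= h L IH /andP[h0 /IH{}IH] /IH; exact: le_step. Qed.

Lemma steps_cat L1 L2 f : steps (L1 ++ L2) f = steps L1 (steps L2 f).
Proof. exact: foldr_cat. Qed.

Lemma steps_const_le L (c : R) i : all (fun h => 0 <= h) L -> 0 <= c ->
  (steps L (fun=> c%:E) i <= c%:E)%E.
Proof.
move=> + c0; elim: L i => //= h L IH i /andP[h0 L0].
exact: le_trans (le_step h0 (fun j => IH j L0) i) (step_const_le _ _ _).
Qed.

Lemma esum_indic_at (w : E -> R) i : (forall j, 0 <= w j) ->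
  (\esum_(k in [set: E]) (indic_at k i * (w k)%:E) = (w i)%:E)%E.
Proof.
move=> w0; rewrite (esumD1 i) => [|j]; last first.
  by rewrite mule_ge0 ?indic_at_ge0// lee_fin.
rewrite esum1 => [|j /= ji]; last by rewrite /indic_at eq_sym (negPf ji) mul0e.
by rewrite /indic_at eqxx mul1e adde0.
Qed.

(** The kernels commute with countable non-negative sums, so a product of them acts through its
    matrix entries [steps L (indic_at k) i]. *)
Lemma steps_matrix L w i : all (fun h => 0 <= h) L -> (forall j, 0 <= w j) ->
  (steps L (EFin \o w) i =
   \esum_(k in [set: E]) (steps L (indic_at k) i * (w k)%:E))%E.
Proof.
move=> + w0; elim: L i => [i _|h L IH i /= /andP[h0 L0]].
  by rewrite /= esum_indic_at.
have S0 k j : (0 <= steps L (indic_at k) j)%E.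
  by apply: steps_ge0 => // j'; exact: indic_at_ge0.
have Sw0 k j : (0 <= steps L (indic_at k) j * (w k)%:E)%E.
  by rewrite mule_ge0 ?lee_fin.
have -> : steps L (EFin \o w) =
    fun j => (\esum_(k in [set: E]) (steps L (indic_at k) j * (w k)%:E))%E.
  by apply/funext => j; exact: IH.
rewrite /step -ge0_esumZl ?stay_ge0//.
under [X in (_ + X)%E]eq_esum => j ji do rewrite -ge0_esumZl ?jump_ge0//.
have JS0 j k : j != i ->
    (0 <= (jump h i j)%:E * (steps L (indic_at k) j * (w k)%:E))%E.
  by move=> ji; rewrite !mule_ge0 ?lee_fin ?jump_ge0.
rewrite esum_exchange => [|j k ji _]; last exact: JS0.
rewrite -esumD; first last.
- by move=> k _; apply: esum_ge0 => j; exact: JS0.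
- by move=> k _; rewrite mule_ge0 ?lee_fin ?stay_ge0.
apply: eq_esum => k _.
under [X in (_ + X)%E]eq_esum => j ji do rewrite muleA muleC.
rewrite ge0_esumZl//; last by move=> j ji; rewrite mule_ge0 ?lee_fin ?jump_ge0.
rewrite [RHS]muleC ge0_muleDr.
- by congr (_ + _)%E; rewrite muleA muleC.
- by rewrite mule_ge0 ?lee_fin ?stay_ge0.
- by apply: esum_ge0 => j ji; rewrite mule_ge0 ?lee_fin ?jump_ge0.
Qed.

Lemma step_le_steps h L f : subdivision h L -> (forall j, 0 <= f j)%E ->
  forall i, (step h f i <= steps L f i)%E.
Proof.
move=> + f0; elim: L h => [h [_]|a L IH h].
  by rewrite big_nil => <- i; rewrite step0.
move=> /subdivision_cons[a0 hL] i /=.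
rewrite -{1}(subrK a h) addrC.
apply: (le_trans (step_superadditive a0 (subdivision_ge0 hL) f0 i)).
by apply: le_step => // j; exact: IH.
Qed.

(** The step of [L] that straddles [s] is cut in two, which by superadditivity can only increase the
    product. *)
Lemma subdivision_split s t L : 0 <= s -> 0 <= t -> subdivision (s + t) L ->
  exists L1 L2, [/\ subdivision s L1, subdivision t L2 &
    forall f, (forall j, 0 <= f j)%E ->
      forall i, (steps L f i <= steps L1 (steps L2 f) i)%E].
Proof.
move=> s0 t0; elim: L s s0 => [|h L IH] s s0.
  move=> [_]; rewrite big_nil => /esym/eqP; rewrite paddr_eq0// => /andP[/eqP-> /eqP->].
  by exists [::], [::]; split => //; split => //; rewrite big_nil.
move=> /subdivision_cons[h0 hL]; have [sh|hs] := leP s h.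
  exists [:: s], (h - s :: L); split.
  - exact: subdivision1.
  - apply/subdivision_cons; rewrite subr_ge0; split => //.
    by rewrite opprB addrCA addrA.
  - move=> f f0 i /=; rewrite -{1}(subrK s h) addrC.
    apply: step_superadditive; rewrite ?subr_ge0//.
    by apply: steps_ge0 => //; exact: hL.1.
have sh0 : 0 <= s - h by rewrite subr_ge0 ltW.
have [|L1 [L2 [L1s L2t le]]] := IH (s - h) sh0; first by rewrite addrAC.
exists (h :: L1), L2; split => //; first by apply/subdivision_cons.
by move=> f f0 i /=; apply: le_step => // j; exact: le.
Qed.

(** [L2] is cut at the first point [h] of [L1]; its initial piece refines the step [h], and
    induction treats the rest. This makes the family of products directed. *)
Lemma subdivision_refine t L1 L2 : subdivision t L1 -> subdivision t L2 ->
  exists2 L, subdivision t L & forall f, (forall j, 0 <= f j)%E -> forall i,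
    (steps L1 f i <= steps L f i)%E /\ (steps L2 f i <= steps L f i)%E.
Proof.
elim: L1 t L2 => [|h L1 IH] t L2.
  move=> [_]; rewrite big_nil => <- L20; exists L2 => // f f0 i; split=> //=.
  by rewrite -[leLHS](congr1 (fun g => g i) (step0 f0)) step_le_steps.
move=> /subdivision_cons[h0 tL1]; rewrite -{1}(subrK h t) addrC.
move=> /(subdivision_split h0 (subdivision_ge0 tL1)) [La [Lb [hLa tLb le]]].
have [L tL leL] := IH _ _ tL1 tLb.
exists (La ++ L) => [|f f0 i].
  by rewrite -(subrK h t) addrC; exact: subdivision_cat.
have Lf0 j : (0 <= steps L f j)%E by apply: steps_ge0 => //; exact: tL.1.
rewrite steps_cat; split=> /=.
  apply: (@le_trans _ _ (step h (steps L f) i)).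
    by apply: le_step => // j; exact: (leL f f0 j).1.
  exact: step_le_steps.
apply: (le_trans (le f f0 i)).
by apply: le_steps => [|j]; [exact: hLa.1|exact: (leL f f0 j).2].
Qed.

End steps.

(** * The minimal process *)

Section minimal_process.
Context {R : realType} {E : countType} (Q : E -> E -> R).
Context (Q_matrix : is_Qmatrix Q).
Implicit Types (s t : R) (i j k : E) (w : E -> R) (L : seq R).

Let q := exit_rate Q.
Let P := min_prob Q.

Lemma steps_indic_at_le1 L i j : all (fun h => 0 <= h) L ->
  (steps Q L (indic_at j) i <= 1)%E.
Proof.
move=> L0; apply: le_trans (steps_const_le Q_matrix i L0 ler01).
by apply: le_steps => // k; rewrite /indic_at lee_fin lern1; case: eqP.
Qed.

Lemma steps_indic_at_fin_num L i j : all (fun h => 0 <= h) L ->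
  steps Q L (indic_at j) i \is a fin_num.
Proof.
move=> L0; rewrite ge0_fin_numE; last first.
  by apply: steps_ge0 => // k; exact: indic_at_ge0.
exact: le_lt_trans (steps_indic_at_le1 i j L0) (ltry _).
Qed.

Lemma min_prob_fin_num t i j : 0 <= t ->
  ereal_sup [set steps Q L (indic_at j) i | L in subdivision t] \is a fin_num.
Proof.
move=> t0; rewrite ge0_fin_numE.
  apply: (@le_lt_trans _ _ 1%E); last exact: ltry.
  by apply: ge_ereal_sup => _ [L [L0 _] <-]; exact: steps_indic_at_le1.
apply: le_ereal_sup_tmp; exists (steps Q [:: t] (indic_at j) i).
  by exists [:: t] => //; exact: subdivision1.
by apply: steps_ge0 => [//||k]; [rewrite /= t0|exact: indic_at_ge0].
Qed.

Lemma steps_le_min_prob t i j L : subdivision t L ->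
  (steps Q L (indic_at j) i <= (P t i j)%:E)%E.
Proof.
move=> tL; rewrite /P /min_prob fineK; last first.
  by apply: min_prob_fin_num; exact: subdivision_ge0 tL.
by apply: ereal_sup_ubound; exists L.
Qed.

Lemma min_prob_le t i j (u : \bar R) : 0 <= t ->
  (forall L, subdivision t L -> (steps Q L (indic_at j) i <= u)%E) ->
  ((P t i j)%:E <= u)%E.
Proof.
move=> t0 Lu; rewrite /P /min_prob fineK; last exact: min_prob_fin_num.
by apply: ge_ereal_sup => _ [L /Lu ? <-].
Qed.

Lemma min_prob_ge0 t i j : 0 <= t -> 0 <= P t i j.
Proof.
move=> t0; rewrite -lee_fin.
apply: le_trans (steps_le_min_prob i j (subdivision1 t0)).
by apply: steps_ge0 => [//||k]; [rewrite /= t0|exact: indic_at_ge0].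
Qed.

Lemma min_prob_adherent t i j (e : R) : 0 <= t -> 0 < e ->
  exists2 L, subdivision t L & P t i j <= fine (steps Q L (indic_at j) i) + e.
Proof.
move=> t0 e0; have [_ [L tL <-] lt] :=
  ub_ereal_sup_adherent e0 (min_prob_fin_num i j t0).
exists L => //; have Lfin := steps_indic_at_fin_num i j tL.1.
rewrite -lee_fin EFinD [X in (_ <= X + _)%E]fineK// -leeBlDr//.
by rewrite /P /min_prob fineK ?min_prob_fin_num// ltW.
Qed.

(** Directedness lets the supremum pass through the sum; in this way upper bounds on kernel products
    become upper bounds on averages under [P]. *)
Lemma esum_min_prob_le t i w (u : \bar R) : 0 <= t -> (forall j, 0 <= w j) ->
  (forall L, subdivision t L -> (steps Q L (EFin \o w) i <= u)%E) ->
  (\esum_(j in [set: E]) (P t i j * w j)%:E <= u)%E.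
Proof.
move=> t0 w0 Lu; under eq_esum => j _ do rewrite mulrC.
apply: (@esum_le_directed _ _ _ (subdivision t)
    (fun L j => fine (steps Q L (indic_at j) i))) => //.
- by exists [:: t]; exact: subdivision1.
- move=> L1 L2 tL1 tL2; have [L tL leL] := subdivision_refine Q_matrix tL1 tL2.
  exists L => // j; have [] := leL (indic_at j) (indic_at_ge0 j) i.
  by move=> le1 le2; split; apply: fine_le => //;
    apply: steps_indic_at_fin_num; [exact: tL1.1|exact: tL.1|exact: tL2.1|exact: tL.1].
- by move=> j e e0; exact: min_prob_adherent.
- move=> L j tL; apply: fine_ge0; apply: steps_ge0 => //; first exact: tL.1.
  by move=> k; exact: indic_at_ge0.
- move=> L tL; apply: le_trans (Lu L tL); rewrite steps_matrix//; last exact: tL.1.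
  apply: le_esum => j _; rewrite mulrC EFinM fineK//.
  exact: (steps_indic_at_fin_num _ _ tL.1).
Qed.

Lemma esum_min_prob_le1 t i : 0 <= t ->
  (\esum_(j in [set: E]) (P t i j)%:E <= 1)%E.
Proof.
move=> t0; under eq_esum => j _ do rewrite -[P t i j]mulr1.
apply: (@esum_min_prob_le t i (fun=> 1)) => // L tL.
exact: (steps_const_le Q_matrix i tL.1 ler01).
Qed.

Lemma min_prob0 i j : P 0 i j = (i == j)%:R.
Proof.
have L0 L : subdivision 0 L -> steps Q L (indic_at j) = indic_at j.
  elim: L => //= h L IH /subdivision_cons[h0 hL].
  have h00 : h = 0.
    apply/eqP; rewrite eq_le h0 andbT.
    by have := subdivision_ge0 hL; rewrite sub0r oppr_ge0.
  by move: hL; rewrite h00 subr0 => /IH ->; rewrite step0// => k; exact: indic_at_ge0.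
apply/eqP; rewrite -eqe eq_le min_prob_le// => [/=|L /L0 ->//].
by rewrite -/(indic_at j i) -[X in (X <= _)%E](congr1 (fun g => g i) (L0 [::] _));
  [apply: steps_le_min_prob|]; split => //; rewrite big_nil.
Qed.

(** For one inequality a subdivision of [s + t] is cut at [s]; for the other, subdivisions of [s]
    and [t] are concatenated, and directedness is used once for each of the two times. *)
Lemma min_prob_chapman_kolmogorov s t i j : 0 <= s -> 0 <= t ->
  (P (s + t) i j)%:E = (\esum_(k in [set: E]) (P s i k * P t k j)%:E)%E.
Proof.
move=> s0 t0; have st0 : 0 <= s + t by rewrite addr_ge0.
pose v L k := fine (steps Q L (indic_at j) k).
have vE L : all (fun h => 0 <= h) L -> EFin \o v L = steps Q L (indic_at j).
  by move=> L0; apply/funext => k /=; rewrite fineK// steps_indic_at_fin_num.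
have v0 L k : all (fun h => 0 <= h) L -> 0 <= v L k.
  by move=> L0; rewrite fine_ge0// steps_ge0// => ?; exact: indic_at_ge0.
apply/eqP; rewrite eq_le; apply/andP; split.
  apply: min_prob_le => // L /(subdivision_split Q_matrix s0 t0).
  move=> [L1 [L2 [sL1 tL2 /(_ _ (indic_at_ge0 j) i)]]] /le_trans; apply.
  rewrite -(vE _ tL2.1) steps_matrix//; last 2 first.
  - exact: sL1.1.
  - by move=> k; apply: v0; exact: tL2.1.
  apply: le_esum => k _; rewrite EFinM; apply: lee_pmul.
  - by apply: steps_ge0 => //; [exact: sL1.1|move=> ?; exact: indic_at_ge0].
  - by rewrite lee_fin v0//; exact: tL2.1.
  - exact: steps_le_min_prob.
  - by have /= := congr1 (fun g => g k) (vE _ tL2.1) => ->; exact: steps_le_min_prob.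
apply: (@esum_le_directed _ _ _ (subdivision t) v (fun k => P s i k)) => //.
- by exists [:: t]; exact: subdivision1.
- by move=> k; exact: min_prob_ge0.
- move=> L1 L2 tL1 tL2; have [L tL leL] := subdivision_refine Q_matrix tL1 tL2.
  exists L => // k; have [] := leL (indic_at j) (indic_at_ge0 j) k.
  by move=> le1 le2; split; apply: fine_le => //;
    apply: steps_indic_at_fin_num; [exact: tL1.1|exact: tL.1|exact: tL2.1|exact: tL.1].
- by move=> k e e0; exact: min_prob_adherent.
- by move=> L k tL; apply: v0; exact: tL.1.
- move=> L tL; apply: esum_min_prob_le => // [k|L1 sL1].
    by apply: v0; exact: tL.1.
  rewrite (vE _ tL.1) -steps_cat; apply: steps_le_min_prob.
  exact: subdivision_cat.
Qed.

(** Bounds the [t ^+ 2] error made when [jump t i j] is replaced by [t * Q i j]. *)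
Definition second_order i j : R := if j == i then 0 else Q i j * (q i + q j).

Lemma second_order_ge0 i j : 0 <= second_order i j.
Proof.
rewrite /second_order; case: eqVneq => // ji.
by rewrite mulr_ge0 ?addr_ge0 ?exit_rate_ge0 ?Qmatrix_ge0.
Qed.

Lemma min_prob_ge t i j : 0 <= t ->
  (i == j)%:R + t * Q i j - t ^+ 2 * second_order i j <= P t i j.
Proof.
move=> t0; rewrite -lee_fin.
apply: le_trans (steps_le_min_prob i j (subdivision1 t0)).
have J0 l k : k != i -> (0 <= (jump Q t i k)%:E * indic_at l k)%E.
  by move=> ki; rewrite mule_ge0 ?lee_fin ?jump_ge0 ?indic_at_ge0.
rewrite /= /step /second_order; have [->|ji] := eqVneq j i.
  rewrite mulr0 subr0 {1}/indic_at eqxx mule1.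
  apply: (@le_trans _ _ (stay Q t i)%:E); last by rewrite leeDl// esum_ge0//; exact: J0.
  by rewrite lee_fin (le_trans _ (stay_ge _ _ _))// /exit_rate mulrN opprK.
have -> : indic_at j i = 0%E :> \bar R by rewrite /indic_at eq_sym (negPf ji).
rewrite mule0 !add0r.
apply: le_trans (esum_ge1 (J0 j) ji).
rewrite /indic_at eqxx mule1 lee_fin /jump.
have := Qmatrix_ge0 Q_matrix ji.
have := stay_ge Q t i; have := stay_ge Q t j.
have := stay_ge0 Q t i; have := stay_ge0 Q t j.
have := exit_rate_ge0 Q_matrix i; have := exit_rate_ge0 Q_matrix j.
rewrite -/q; set a := stay Q t i; set b := stay Q t j.
move=> qj qi b0 a0 tb ta Q0.
have ab : 1 - t * (q i + q j) <= a * b.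
  have [ti|ti] := leP (t * q i) 1; have [tj|tj] := leP (t * q j) 1; try nra.
  apply: le_trans (_ : _ <= (1 - t * q i) * (1 - t * q j)) _.
    by have := mulr_ge0 (mulr_ge0 t0 qi) (mulr_ge0 t0 qj); nra.
  by apply: ler_pM; rewrite ?subr_ge0.
rewrite [leLHS](_ : _ = t * Q i j * (1 - t * (q i + q j))); last by ring.
by rewrite ler_wpM2l// mulr_ge0.
Qed.

(** As the total mass is at most 1, the lower bounds on the other entries in [s] give an upper bound
    on the entry [j]. *)
Lemma min_prob_le_Q t i j (s : seq E) : 0 <= t -> uniq s -> i \in s -> j \in s ->
  P t i j <= (i == j)%:R + t * Q i j - t * (\sum_(k <- s) Q i k)
    + t ^+ 2 * \sum_(k <- s) second_order i k.
Proof.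
move=> t0 us si sj.
have sum1 : \sum_(k <- s) P t i k <= 1.
  rewrite -lee_fin -sumEFin; apply: le_trans (esum_min_prob_le1 i t0).
  by apply: seq_le_esum => // k _; rewrite lee_fin min_prob_ge0.
have sum_delta : \sum_(k <- s) (i == k)%:R = 1 :> R.
  rewrite (bigD1_seq i)//= eqxx big1 ?addr0// => k.
  by rewrite eq_sym => /negPf ->.
have low : \sum_(k <- s | k != j)
    ((i == k)%:R + t * Q i k - t ^+ 2 * second_order i k) <=
    \sum_(k <- s | k != j) P t i k.
  by apply: ler_sum => k _; exact: min_prob_ge.
have cj := mulr_ge0 (sqr_ge0 t) (second_order_ge0 i j).
move: sum1 sum_delta low.
rewrite !sumrB !big_split/= -!mulr_sumr.
rewrite (bigD1_seq j sj us)/= (bigD1_seq j sj us)/=.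
rewrite (bigD1_seq j (F := Q i) sj us)/= (bigD1_seq j (F := second_order i) sj us)/=.
lra.
Qed.

Lemma min_prob_derivative i j :
  (P t i j - (i == j)%:R) / t @[t --> 0^'+] --> Q i j.
Proof.
apply/cvgrPdist_le => e e0.
(* Row [i] of [Q] sums to 0, so a large enough finite set has partial row sum at least
   [- (e / 2)]. *)
have [s [us si sj sQ]] : exists s : seq E,
    [/\ uniq s, i \in s, j \in s & - (e / 2) <= \sum_(k <- s) Q i k].
  have lt : ((q i - e / 2)%:E < \esum_(k in [set k | k != i]) (Q i k)%:E)%E.
    by rewrite Q_matrix.2 lte_fin gtrBl divr_gt0.
  have [s [us si]] := esum_gt_seq lt; rewrite sumEFin lte_fin => sQ.
  (* [j] is adjoined only if it is neither [i] nor already present; [i] is put in front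
     afterwards. *)
  pose s' : seq E := if j == i then s else if j \in s then s else j :: s.
  have us' : uniq s' by rewrite /s'; case: eqP => // _; case: ifPn => //= ->.
  have s'i k : k \in s' -> k != i.
    rewrite /s'; case: eqVneq => [_ /si//|ji]; case: ifPn => [_ /si//|_].
    by rewrite inE => /predU1P[->//|/si].
  have sQ' : q i - e / 2 < \sum_(k <- s') Q i k.
    rewrite /s'; case: eqVneq => // ji; case: ifPn => // _.
    by rewrite big_cons (lt_le_trans sQ)// lerDr Qmatrix_ge0.
  exists (i :: s'); split.
  - by rewrite /= us' andbT; apply/negP => /s'i; rewrite eqxx.
  - exact: mem_head.
  - rewrite inE /s'; case: eqVneq => //= _; case: ifPn => //= _.
    exact: mem_head.
  - by rewrite big_cons; move: sQ'; rewrite /q /exit_rate; lra.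
pose C := \sum_(k <- s) second_order i k.
have C0 : 0 <= C by apply: sumr_ge0 => k _; exact: second_order_ge0.
have Cj : second_order i j <= C.
  rewrite /C (bigD1_seq j)//= lerDl; apply: sumr_ge0 => k _; exact: second_order_ge0.
(* Below this threshold [t * C] is at most [e / 2]; the other half of [e] covers the row sum over
   [s]. *)
have d0 : 0 < e / 2 / (C + 1) by rewrite !divr_gt0// ltr_pwDr.
near=> t.
have t0 : 0 < t by near: t; exact: nbhs_right_gt.
have : t <= e / 2 / (C + 1) by near: t; apply: nbhs_right_le.
rewrite ler_pdivlMr ?ltr_pwDr// => tC.
have tCj : t * second_order i j <= t * C by rewrite ler_wpM2l// ltW.
have low := min_prob_ge i j (ltW t0).
have upp := min_prob_le_Q (ltW t0) us si sj; rewrite -/C in upp.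
rewrite ler_distlC; apply/andP; split.
  rewrite ler_pdivlMr//; nra.
rewrite ler_pdivrMr//; nra.
Unshelve. all: by end_near. Qed.

Lemma min_prob_standard i j : P t i j @[t --> 0^'+] --> ((i == j)%:R : R).
Proof.
have t0 : (t : R) @[t --> 0^'+] --> (0 : R).
  by apply: cvg_at_right_filter; exact: cvg_id.
have h : (i == j)%:R + t * ((P t i j - (i == j)%:R) / t) @[t --> 0^'+] -->
    (i == j)%:R + 0 * Q i j.
  by apply: cvgD; [exact: cvg_cst|apply: cvgM => //; exact: min_prob_derivative].
rewrite mul0r addr0 in h; apply: cvg_trans h; apply: near_eq_cvg; near=> t.
have : 0 < t by near: t; exact: nbhs_right_gt.
by move=> tp /=; rewrite mulrCA divff ?gt_eqF// mulr1 addrC subrK.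
Unshelve. all: by end_near. Qed.

Lemma min_prob_is_Qprocess : is_Qprocess Q P.
Proof.
split; last exact: min_prob_derivative.
split.
- by move=> t i j; exact: min_prob_ge0.
- by move=> t i; exact: esum_min_prob_le1.
- exact: min_prob0.
- by move=> s t i j; exact: min_prob_chapman_kolmogorov.
- exact: min_prob_standard.
Qed.

End minimal_process.

(** * Doeblin's condition *)

Section doeblin.
Context {R : realType} {E : countType} (P : R -> E -> E -> R).
Context (P_tf : is_transition_function P) (P_mass : non_explosive P).
Implicit Types (s t : R) (i j k : E) (w : E -> R) (A : seq E).

(** As no mass is lost, the averages of [w] and [hi - w] add up to [hi]; of the latter only the term
    at [l] is kept. *)
Lemma average_le t i l w (hi : R) : 0 <= t -> (forall k, 0 <= w k <= hi) ->
  (\esum_(k in [set: E]) (P t i k * w k)%:E <= (hi - P t i l * (hi - w l))%:E)%E.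
Proof.
move=> t0 whi; have P0 := tf_ge0 P_tf i _ t0.
have w0 k : 0 <= w k by case/andP: (whi k).
have wh k : w k <= hi by case/andP: (whi k).
have h0 k : 0 <= P t i k * (hi - w k) by rewrite mulr_ge0 ?subr_ge0.
have hi0 : 0 <= hi by exact: le_trans (w0 l) (wh l).
have sumE : (\esum_(k in [set: E]) (P t i k * w k)%:E +
    \esum_(k in [set: E]) (P t i k * (hi - w k))%:E = hi%:E)%E.
  rewrite -esumD; last 2 first.
  - by move=> k _; rewrite lee_fin mulr_ge0.
  - by move=> k _; rewrite lee_fin.
  under eq_esum => k _ do rewrite -EFinD -mulrDr addrC subrK mulrC EFinM.
  by rewrite ge0_esumZl ?P_mass ?mule1// => k _; rewrite lee_fin.
rewrite EFinB leeBrDr// -sumE leeD2l//.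
by apply: (@esum_ge1 _ _ _ (fun k => (P t i k * (hi - w k))%:E)) => // k _;
  rewrite lee_fin.
Qed.

Lemma average_ge t i l w (lo : R) : 0 <= t -> 0 <= lo -> (forall k, lo <= w k) ->
  ((lo + P t i l * (w l - lo))%:E <= \esum_(k in [set: E]) (P t i k * w k)%:E)%E.
Proof.
move=> t0 lo0 low; have P0 := tf_ge0 P_tf i _ t0.
have h0 k : 0 <= P t i k * (w k - lo) by rewrite mulr_ge0 ?subr_ge0.
have -> : (\esum_(k in [set: E]) (P t i k * w k)%:E = lo%:E +
    \esum_(k in [set: E]) (P t i k * (w k - lo))%:E)%E.
  have <- : (\esum_(k in [set: E]) (lo%:E * (P t i k)%:E) = lo%:E)%E.
    by rewrite ge0_esumZl ?P_mass ?mule1// => k _; rewrite lee_fin.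
  rewrite -esumD; last 2 first.
  - by move=> k _; rewrite mule_ge0 ?lee_fin.
  - by move=> k _; rewrite lee_fin.
  by apply: eq_esum => k _; rewrite -EFinM -EFinD; congr (_%:E); ring.
rewrite EFinD leeD2l//.
by apply: (@esum_ge1 _ _ _ (fun k => (P t i k * (w k - lo))%:E)) => // k _;
  rewrite lee_fin.
Qed.

Let mass A t i := \sum_(j <- A) P t i j.

Lemma massD A s t i : 0 <= s -> 0 <= t ->
  ((mass A (s + t) i)%:E = \esum_(k in [set: E]) (P s i k * mass A t k)%:E)%E.
Proof.
move=> s0 t0; rewrite -sumEFin.
under eq_bigr => j _ do rewrite (tf_chapman_kolmogorov P_tf)//.
rewrite -esum_sum; first last.
  by move=> k j _ _; rewrite lee_fin mulr_ge0 ?(tf_ge0 P_tf).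
by apply: eq_esum => k _; rewrite sumEFin mulr_sumr.
Qed.

Lemma mass_ge0 A t i : 0 <= t -> 0 <= mass A t i.
Proof. by move=> t0; apply: sumr_ge0 => j _; exact: (tf_ge0 P_tf). Qed.

Lemma mass_le1 A t i : 0 <= t -> uniq A -> mass A t i <= 1.
Proof.
move=> t0 uA; rewrite -lee_fin -sumEFin -(P_mass i t0).
by apply: seq_le_esum => // j _; rewrite lee_fin (tf_ge0 P_tf).
Qed.

Lemma mass_bounds_after A s t i (lo hi : R) : 0 <= s -> 0 <= t -> 0 <= lo ->
  (forall k, lo <= mass A t k <= hi) -> lo <= mass A (s + t) i <= hi.
Proof.
move=> s0 t0 lo0 lohi; rewrite -!lee_fin massD//; apply/andP; split.
  apply: le_trans (@average_ge s i i _ lo s0 lo0 _); last first.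
    by move=> k; case/andP: (lohi k).
  rewrite lee_fin lerDl mulr_ge0 ?(tf_ge0 P_tf)// subr_ge0.
  by case/andP: (lohi i).
apply: le_trans (@average_le s i i (mass A t) hi s0 _) _.
  by move=> k; rewrite mass_ge0//; case/andP: (lohi k).
rewrite lee_fin gerBl mulr_ge0 ?(tf_ge0 P_tf)// subr_ge0.
by case/andP: (lohi i).
Qed.

Context (t0 e : R) (j0 : E).
Context (t0_gt0 : 0 < t0) (e_gt0 : 0 < e) (doeblin : forall i, e <= P t0 i j0).

Let r := 1 - e.

Lemma doeblin_rate_ge0 : 0 <= r.
Proof.
rewrite subr_ge0; apply: le_trans (doeblin j0) _.
have := mass_le1 j0 (ltW t0_gt0) (isT : uniq [:: j0]).
by rewrite /mass big_seq1.
Qed.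

Lemma rate_expr_small (eta : R) : 0 < eta -> exists n, r ^+ n <= eta.
Proof.
move=> eta0.
have r1 : `|r| < 1 by rewrite ger0_norm ?doeblin_rate_ge0// gtrBl.
have /cvgrPdist_le/(_ _ eta0)[n _ /(_ n (leqnn _))] := cvg_expr r1.
by rewrite /= sub0r normrN ger0_norm ?exprn_ge0 ?doeblin_rate_ge0//; exists n.
Qed.

(** After time [t0] every state puts mass at least [e] on [j0], which pulls both bounds towards the
    value at [j0] and shrinks their gap by the factor [r]. *)
Lemma mass_oscillation A n t : uniq A -> n%:R * t0 <= t ->
  exists lo hi, [/\ 0 <= lo, hi - lo <= r ^+ n &
    forall i, lo <= mass A t i <= hi].
Proof.
move=> uA; elim: n t => [|n IH] t nt.
  exists 0, 1; rewrite mul0r in nt; split => // [|i]; first by rewrite subr0.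
  by rewrite mass_ge0 ?mass_le1.
have {}nt : n%:R * t0 <= t - t0 by move: nt; rewrite -natr1 mulrDl mul1r; lra.
have t'0 : 0 <= t - t0 by apply: le_trans nt; rewrite mulr_ge0// ltW.
have [lo [hi [lo0 osc lohi]]] := IH _ nt.
have tE : t = t0 + (t - t0) by rewrite addrC subrK.
have lohi0 := lohi j0; case/andP: lohi0 => lo_j0 j0_hi.
set a := mass A (t - t0) j0 in lo_j0 j0_hi.
exists (lo + e * (a - lo)), (hi - e * (hi - a)); split.
- by rewrite addr_ge0// mulr_ge0 ?subr_ge0// ltW.
- rewrite (_ : _ - _ = r * (hi - lo)); last by rewrite /r; ring.
  by rewrite exprS ler_wpM2l// doeblin_rate_ge0.
- move=> i; rewrite tE -!lee_fin massD ?(ltW t0_gt0)//; apply/andP; split.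
    apply: le_trans (@average_ge t0 i j0 _ lo (ltW t0_gt0) lo0 _); last first.
      by move=> k; case/andP: (lohi k).
    by rewrite lee_fin lerD2l ler_wpM2r ?subr_ge0.
  apply: le_trans (@average_le t0 i j0 (mass A (t - t0)) hi (ltW t0_gt0) _) _.
    by move=> k; rewrite mass_ge0//; case/andP: (lohi k).
  by rewrite lee_fin lerD2l lerN2 ler_wpM2r ?subr_ge0.
Qed.

Let lower j := [set lo : R | 0 <= lo /\
  exists2 t, 0 <= t & forall i, lo <= P t i j].

(** The infimum over [i] of [P t i j] is non-decreasing in [t], so this supremum over all times is
    its limit. *)
Definition doeblin_limit j : R := sup (lower j).

Let pi := doeblin_limit.

Lemma mass1 t i j : mass [:: j] t i = P t i j.
Proof. by rewrite /mass big_seq1. Qed.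

Lemma lower_has_sup j : has_sup (lower j).
Proof.
split; first by exists 0; split => //; exists 0 => // i; exact: (tf_ge0 P_tf).
exists 1 => lo [_ [t tp /(_ j) /le_trans]]; apply.
by rewrite -mass1 mass_le1.
Qed.

Lemma doeblin_limit_ge0 j : 0 <= pi j.
Proof.
apply: sup_upper_bound; first exact: lower_has_sup.
by split => //; exists 0 => // i; exact: (tf_ge0 P_tf).
Qed.

Lemma doeblin_limit_dist n t i j : n%:R * t0 <= t -> `|P t i j - pi j| <= r ^+ n.
Proof.
move=> nt; have tp : 0 <= t by apply: le_trans nt; rewrite mulr_ge0// ltW.
have [lo [hi [lo0 osc lohi]]] := mass_oscillation (isT : uniq [:: j]) nt.
have lo_pi : lo <= pi j.
  apply: sup_upper_bound; first exact: lower_has_sup.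
  by split => //; exists t => // k; rewrite -mass1; case/andP: (lohi k).
have pi_hi : pi j <= hi.
  apply: ge_sup; first exact: (lower_has_sup j).1.
  (* The lower bound at time [s] and the upper bound at time [t] both persist at time [s + t], where
     they are compared. *)
  move=> lo' [lo'0 [s sp lo's]].
  have /andP[_ le_hi] := mass_bounds_after i sp tp lo0 lohi.
  have lo's' k : lo' <= mass [:: j] s k <= 1 by rewrite mass1 lo's -mass1 mass_le1.
  have /andP[+ _] := mass_bounds_after i tp sp lo'0 lo's'.
  by rewrite addrC => /le_trans; apply.
have := lohi i; rewrite mass1 => /andP[? ?].
by apply: le_trans osc; rewrite ler_norml; apply/andP; split; lra.
Qed.

(** The bound must not depend on [A], so it comes from the oscillation of the mass of [A] as a
    whole, not from a sum of pointwise distances. *)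
Lemma doeblin_limit_sum_dist n t i A : uniq A -> n%:R * t0 <= t ->
  `|\sum_(j <- A) (P t i j - pi j)| <= r ^+ n.
Proof.
move=> uA nt; have tp : 0 <= t by apply: le_trans nt; rewrite mulr_ge0// ltW.
have [lo [hi [lo0 osc lohi]]] := mass_oscillation uA nt.
apply/ler_addgt0Pr => eta eta0.
(* [pi] is compared with the law at a much later time; [N] is so large that the pointwise errors
   summed over [A] stay below [eta]. *)
have [|N rN] := @rate_expr_small (eta / (size A).+1%:R); first by rewrite divr_gt0.
have Nt0 : 0 <= N%:R * t0 by rewrite mulr_ge0// ltW.
have later := mass_bounds_after i Nt0 tp lo0 lohi.
have now := lohi i.
rewrite (_ : \sum_(j <- A) _ = (mass A t i - mass A (N%:R * t0 + t) i) +
    \sum_(j <- A) (P (N%:R * t0 + t) i j - pi j)); last first.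
  by rewrite !sumrB /mass; ring.
apply: le_trans (ler_normD _ _) _; apply: lerD.
  case/andP: later => ? ?; case/andP: now => ? ?.
  by apply: le_trans osc; rewrite ler_norml; apply/andP; split; lra.
apply: le_trans (ler_norm_sum _ _ _) _.
apply: (@le_trans _ _ (\sum_(j <- A) (eta / (size A).+1%:R))).
  apply: ler_sum => j _; apply: le_trans rN.
  by apply: doeblin_limit_dist; rewrite lerDl.
rewrite big_const_seq count_predT iter_addr_0 -[leLHS]mulr_natr.
rewrite mulrAC ler_pdivrMr ?ltr0n// ler_wpM2l ?ltW//.
by rewrite ltr_nat.
Qed.

Lemma doeblin_limit_l1_dist n t i : n%:R * t0 <= t ->
  (\esum_(j in [set: E]) `|P t i j - pi j|%:E <= (2 * r ^+ n)%:E)%E.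
Proof.
move=> nt; apply: esum_le_seq => A uA _; rewrite sumEFin lee_fin.
pose x j := P t i j - pi j.
(* The terms of either sign form a signed sum over a finite set, hence contribute at most [r ^+ n]
   each. *)
rewrite (bigID (fun j => 0 <= x j))/= mulr_natl mulr2n; apply: lerD.
  rewrite (eq_bigr x) => [|j xj]; last by rewrite ger0_norm.
  rewrite -big_filter; apply: le_trans (ler_norm _) _.
  by apply: doeblin_limit_sum_dist => //; exact: filter_uniq.
rewrite (eq_bigr (fun j => - x j)) => [|j xj]; last first.
  by rewrite ltr0_norm// ltNge.
rewrite sumrN -big_filter; apply: le_trans (ler_norm _) _; rewrite normrN.
by apply: doeblin_limit_sum_dist => //; exact: filter_uniq.
Qed.

Lemma le_of_rate (x y : \bar R) (c : R) : 0 < c ->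
  (forall n, (x <= y + (c * r ^+ n)%:E)%E) -> (x <= y)%E.
Proof.
move=> c0 xy; apply/lee_addgt0Pr => eta eta0.
have [|n rn] := @rate_expr_small (eta / c); first by rewrite divr_gt0.
apply: le_trans (xy n) _; rewrite leeD2l// lee_fin.
by rewrite mulrC -ler_pdivlMr.
Qed.

Lemma doeblin_limit_stationary : is_stationary_distribution P pi.
Proof.
have nt n : n%:R * t0 <= n%:R * t0 by [].
have nt0 n : 0 <= n%:R * t0 by rewrite mulr_ge0// ltW.
pose T n := n%:R * t0.
have d0 n i j : 0 <= `|P (T n) i j - pi j| by [].
split.
- exact: doeblin_limit_ge0.
- apply/eqP; rewrite eq_le; apply/andP; split; apply: (@le_of_rate _ _ 2) => // n.
    rewrite -(P_mass j0 (nt0 n)).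
    apply: le_trans (leeD2l _ (doeblin_limit_l1_dist j0 (nt n))).
    rewrite -esumD => [|j _|j _]; last 2 first.
    - by rewrite lee_fin (tf_ge0 P_tf).
    - by rewrite lee_fin.
    apply: le_esum => j _; rewrite -EFinD lee_fin.
    by have := ler_norm (- (P (n%:R * t0) j0 j - pi j)); rewrite normrN; lra.
  rewrite -[X in (X <= _)%E](P_mass j0 (nt0 n)).
  apply: le_trans (leeD2l _ (doeblin_limit_l1_dist j0 (nt n))).
  rewrite -esumD => [|j _|j _]; last 2 first.
  - by rewrite lee_fin doeblin_limit_ge0.
  - by rewrite lee_fin.
  apply: le_esum => j _; rewrite -EFinD lee_fin.
  by have := ler_norm (P (n%:R * t0) j0 j - pi j); lra.
- move=> t j tp.
  have P1 k : P t k j <= 1 by rewrite -mass1 mass_le1.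
  have P0 k : 0 <= P t k j by exact: (tf_ge0 P_tf).
  have shift n : `|P (n%:R * t0 + t) j0 j - pi j| <= r ^+ n.
    by apply: doeblin_limit_dist; rewrite lerDl.
  (* The constant 3 is 2 for the l1 distance at time [n%:R * t0] plus 1 for the pointwise distance
     at time [n%:R * t0 + t]. *)
  apply/eqP; rewrite eq_le; apply/andP; split; apply: (@le_of_rate _ _ 3) => // n.
    apply: (@le_trans _ _ ((P (n%:R * t0 + t) j0 j)%:E + (2 * r ^+ n)%:E)%E).
      apply: le_trans (leeD2l _ (doeblin_limit_l1_dist j0 (nt n))).
      rewrite (tf_chapman_kolmogorov P_tf)// -esumD => [|k _|k _]; last 2 first.
      - by rewrite lee_fin mulr_ge0// (tf_ge0 P_tf).
      - by rewrite lee_fin.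
      apply: le_esum => k _; rewrite -EFinD lee_fin.
      have := ler_norm (- (P (n%:R * t0) j0 k - pi k)); rewrite normrN.
      have := d0 n j0 k; rewrite /T; have := P0 k; have := P1 k.
      set d := `|_|; set p := P t k j; set a := P _ _ k; nra.
    rewrite -!EFinD lee_fin.
    by have := shift n; rewrite ler_norml => /andP[_]; lra.
  apply: (@le_trans _ _ ((P (n%:R * t0 + t) j0 j)%:E + (r ^+ n)%:E)%E).
    rewrite -EFinD lee_fin.
    by have := shift n; rewrite ler_norml => /andP[+ _]; lra.
  rewrite (_ : 3 * r ^+ n = 2 * r ^+ n + r ^+ n); last by ring.
  rewrite [in leRHS]EFinD addeA leeD2r//.
  apply: le_trans (leeD2l _ (doeblin_limit_l1_dist j0 (nt n))).
  rewrite (tf_chapman_kolmogorov P_tf)// -esumD => [|k _|k _]; last 2 first.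
  - by rewrite lee_fin mulr_ge0// doeblin_limit_ge0.
  - by rewrite lee_fin.
  apply: le_esum => k _; rewrite -EFinD lee_fin.
  have := ler_norm (P (n%:R * t0) j0 k - pi k).
  have := d0 n j0 k; rewrite /T; have := P0 k; have := P1 k.
  set d := `|_|; set p := P t k j; set a := P _ _ k; nra.
Qed.

Lemma doeblin_strongly_ergodic : strongly_ergodic P.
Proof.
exists pi; first exact: doeblin_limit_stationary.
pose d t := ereal_sup
  [set (\esum_(j in [set: E]) `|P t i j - pi j|%:E)%E | i in [set: E]].
have d0 t : (0 <= d t)%E.
  apply: le_ereal_sup_tmp; eexists; first by exists j0.
  by apply: esum_ge0 => j _; rewrite lee_fin.
have small eta : 0 < eta -> \forall t \near +oo, (d t <= eta%:E)%E.
  move=> eta0; have [|n rn] := @rate_expr_small (eta / 2).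
    by rewrite divr_gt0.
  near=> t; apply: ge_ereal_sup => _ [i _ <-].
  apply: le_trans (doeblin_limit_l1_dist (n := n) _ _) _.
    by near: t; apply: nbhs_pinfty_ge; exact: num_real.
  by rewrite lee_fin mulrC -ler_pdivlMr.
apply/fine_cvgP; split.
  near=> t; rewrite ge0_fin_numE ?d0//.
  apply: (@le_lt_trans _ _ 1%E); last exact: ltry.
  by near: t; exact: small.
apply/cvgrPdist_le => eta eta0; near=> t.
have dt : (d t <= eta%:E)%E by near: t; exact: small.
rewrite /= sub0r normrN ger0_norm ?fine_ge0 ?d0//.
rewrite -lee_fin fineK// ge0_fin_numE ?d0//.
exact: le_lt_trans dt (ltry _).
Unshelve. all: by end_near. Qed.

End doeblin.

(** * Subsolutions and strong ergodicity *)

Lemma limn_esup_pinfty (R : realType) (u : (\bar R)^nat) :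
  (forall n, u n < +oo)%E ->
  (ereal_sup [set u n | n in [set: nat]] = +oo <-> limn_esup u = +oo)%E.
Proof.
move=> uoo; rewrite limn_esup_lim (cvg_lim _ (@cvg_esups_inf _ u))//; split=> [supu|].
  have tail n : (esups u n = +oo)%E.
    elim: n => [|n IH].
      by rewrite -supu; congr ereal_sup; apply/seteqP; split=> _ [k _ <-]; exists k.
    apply/eqP; rewrite -leye_eq -IH; apply: ge_ereal_sup => _ [k /= nk <-].
    have [->|kn] := eqVneq k n; last first.
      by apply: ereal_sup_ubound; exists k => //=; rewrite ltn_neqAle eq_sym kn.
    rewrite leNgt; apply/negP => lt.
    suff : (esups u n < +oo)%E by rewrite IH ltxx.
    apply: le_lt_trans (uoo n); apply: ge_ereal_sup => _ [l /= nl <-].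
    have [->//|ln] := eqVneq l n; apply: le_trans (ltW lt).
    by apply: ereal_sup_ubound; exists l => //=; rewrite ltn_neqAle eq_sym ln.
  apply/eqP; rewrite -leye_eq; apply: le_ereal_inf_tmp => _ [n _ <-].
  by rewrite tail.
move=> infu; apply/eqP; rewrite -leye_eq -infu.
apply: ereal_inf_lbound; exists 0%N => //.
by congr ereal_sup; apply/seteqP; split=> _ [k _ <-]; exists k.
Qed.

Lemma sup_outside_bounded (R : realType) (E : countType) (H : set E)
    (y : E -> R) : (sup_outside H y < +oo)%E ->
  exists2 b : R, 0 <= b & forall i, ~ H i -> y i <= b.
Proof.
have ub i : ~ H i -> ((y i)%:E <= sup_outside H y)%E.
  by move=> Hi; apply: ereal_sup_ubound; exists i.
case: (sup_outside H y) ub => [r| |] ub // _.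
  by exists (Num.max 0 r) => [|i /ub]; rewrite ?le_max ?lexx// lee_fin => ->; rewrite orbT.
by exists 0 => // i /ub; rewrite leeNy_eq.
Qed.

Lemma finite_pos_lower_bound (R : realType) (T : eqType) (H : set T) (f : T -> R) :
  finite_set H -> (forall i, H i -> 0 < f i) ->
  exists2 d : R, 0 < d & forall i, H i -> d <= f i.
Proof.
move=> /finite_seqP[s ->] {H}; elim: s => [|a s IH] f0; first by exists 1.
have [|d d0 ds] := IH; first by move=> i si; apply: f0; rewrite /= inE si orbT.
exists (Num.min d (f a)) => [|i /=].
  by rewrite lt_min d0 f0//= mem_head.
rewrite inE => /predU1P[->|/ds]; first by rewrite ge_min lexx orbT.
by move=> di; rewrite ge_min di.
Qed.

Section ergodicity.
Context {R : realType} {E : countType} (Q : E -> E -> R).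
Context (P : R -> E -> E -> R) (H : set E).
Context (Q_matrix : is_Qmatrix Q) (Q_irreducible : irreducible Q).
Context (P_tf : is_transition_function P) (P_mass : non_explosive P).
Context (P_min : forall t i j, 0 <= t -> P t i j = min_prob Q t i j).
Context (H_nonempty : H !=set0) (H_finite : finite_set H).
Implicit Types (s t h : R) (i j k : E) (w y : E -> R) (L : seq R).

Let q := exit_rate Q.
Let Pi := embedding_chain Q.

Lemma steps_le_transition t i j L : subdivision t L ->
  (steps Q L (indic_at j) i <= (P t i j)%:E)%E.
Proof.
by move=> tL; rewrite P_min ?steps_le_min_prob//; exact: subdivision_ge0 tL.
Qed.

Lemma esum_transition_le t i w (u : \bar R) : 0 <= t -> (forall j, 0 <= w j) ->
  (forall L, subdivision t L -> (steps Q L (EFin \o w) i <= u)%E) ->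
  (\esum_(j in [set: E]) (P t i j * w j)%:E <= u)%E.
Proof.
move=> t0 w0 wu; under eq_esum => j _ do rewrite P_min//.
exact: esum_min_prob_le.
Qed.

(** * Positivity of rates and transition probabilities *)

Lemma transition_mul_le s t i k j : 0 <= s -> 0 <= t ->
  P s i k * P t k j <= P (s + t) i j.
Proof.
move=> s0 t0; rewrite -lee_fin (tf_chapman_kolmogorov P_tf)//.
apply: (@esum_ge1 _ _ _ (fun k => (P s i k * P t k j)%:E)) => // l _.
by rewrite lee_fin mulr_ge0 ?(tf_ge0 P_tf).
Qed.

Lemma transition_diag_ge j (T : R) : 0 <= T ->
  exists2 c : R, 0 < c & forall t, 0 <= t <= T -> c <= P t j j.
Proof.
move=> T0; have q0 := exit_rate_ge0 Q_matrix j.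
(* Cutting the time into [n] pieces of length [u] makes [u * q j <= 2^-1], so each piece leads from
   [j] to [j] with probability at least one half. *)
pose n := (Num.truncn (2 * T * q j)).+1.
have n0 : 0 < n%:R :> R by rewrite ltr0n.
have nT : 2 * T * q j <= n%:R by apply/ltW/truncnS_gt.
exists (2^-1 ^+ n) => [|t /andP[t0 tT]]; first by rewrite exprn_gt0// invr_gt0.
pose u := t / n%:R; have u0 : 0 <= u by rewrite divr_ge0.
have half : 2^-1 <= P u j j.
  rewrite P_min//; apply: le_trans (min_prob_ge Q_matrix j j u0).
  rewrite eqxx /second_order eqxx mulr0 subr0 mulr1n.
  have : u * q j <= 2^-1.
    rewrite /u mulrAC ler_pdivrMr//.
    have : t * q j <= T * q j by rewrite ler_wpM2r.
    lra.
  by rewrite /q /exit_rate mulrN; lra.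
have iterP m : 2^-1 ^+ m <= P (m%:R * u) j j.
  elim: m => [|m IH]; first by rewrite mul0r (tf_0 P_tf) eqxx expr0.
  have mu0 : 0 <= m%:R * u by rewrite mulr_ge0.
  rewrite -[m.+1%:R]natr1 mulrDl mul1r addrC.
  apply: le_trans (transition_mul_le j j j u0 mu0).
  by rewrite exprS ler_pM// ?exprn_ge0// invr_ge0.
by have := iterP n; rewrite /u mulrC divfK// gt_eqF.
Qed.

Lemma edge_neq a b : 0 < Q a b -> b != a.
Proof.
move=> Qab; apply/eqP => ba; move: Qab; rewrite ba.
by have := exit_rate_ge0 Q_matrix a; rewrite /exit_rate oppr_ge0 leNgt => /negP.
Qed.

Lemma transition_edge_gt0 t a b : 0 < t -> 0 < Q a b -> 0 < P t a b.
Proof.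
move=> t0 Qab; have ba := edge_neq Qab.
have C0 := second_order_ge0 Q_matrix a b; set C := second_order Q a b in C0.
(* Up to time [u] the first-order term dominates the quadratic error; the remaining time [t - u]
   leads from [b] to [b]. *)
pose u := Num.min t (Q a b / (C + 1)).
have u0 : 0 < u by rewrite lt_min t0 divr_gt0// ltr_pwDr.
have ut : u <= t by rewrite ge_min lexx.
have uC : u * (C + 1) <= Q a b by rewrite -ler_pdivlMr ?ltr_pwDr// ge_min lexx orbT.
have Pu : 0 < P u a b.
  rewrite P_min ?ltW//; apply: lt_le_trans (min_prob_ge Q_matrix a b (ltW u0)).
  rewrite eq_sym (negPf ba) add0r -/C.
  rewrite [ltRHS](_ : _ = u * (Q a b - u * C)); last by ring.
  by rewrite mulr_gt0//; lra.
have tu0 : 0 <= t - u by rewrite subr_ge0.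
have [c c0 cP] := transition_diag_ge b tu0.
have := transition_mul_le a b b (ltW u0) tu0; rewrite subrKC.
by apply: lt_le_trans; rewrite mulr_gt0// (lt_le_trans c0)// cP// tu0 lexx.
Qed.

(** A path of positive rates is followed, each edge using half of the time that is left. *)
Lemma transition_gt0 t i j : 0 < t -> 0 < P t i j.
Proof.
move=> t0; have [s [+ <-]] := Q_irreducible i j.
elim: s i t t0 => [|a s IH] i t t0 /=.
  have [c c0 cP] := transition_diag_ge i (ltW t0) => _.
  by rewrite (lt_le_trans c0)// cP// (ltW t0) lexx.
move=> /andP[Qia path_s]; have t20 : 0 < t / 2 by rewrite divr_gt0.
rewrite (splitr t).
apply: lt_le_trans (transition_mul_le i a _ (ltW t20) (ltW t20)).
by apply: mulr_gt0; [exact: transition_edge_gt0|exact: IH].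
Qed.

(** A path from [i] into [H] exists by irreducibility, and it has a first edge as [i] is not in
    [H]. *)
Lemma exit_rate_gt0 i : ~ H i -> 0 < q i.
Proof.
move=> Hi; have [j Hj] := H_nonempty; have [[|a s] [/= +]] := Q_irreducible i j.
  by move=> _ ij; case: Hi; rewrite ij.
move=> /andP[Qia _ _]; apply: lt_le_trans (Qia) _; rewrite -lee_fin -Q_matrix.2.
apply: (@esum_ge1 _ _ [set j | j != i] (fun j => (Q i j)%:E)) => [k ki|/=].
  by rewrite lee_fin Qmatrix_ge0.
exact: edge_neq.
Qed.

(** * Drift inequalities and the uniform bound on subsolutions *)

Lemma esum_embedding_chain w i : ~ H i -> (forall j, 0 <= w j) ->
  (forall j, H j -> w j = 0) ->
  (\esum_(j in ~` H) (Pi i j * w j)%:E =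
   (q i)^-1%:E * \esum_(j in [set j | j != i]) (Q i j * w j)%:E)%E.
Proof.
move=> Hi w0 wH; rewrite -ge0_esumZl; last 2 first.
- by rewrite invr_ge0 ltW// exit_rate_gt0.
- by move=> j ji; rewrite lee_fin mulr_ge0// Qmatrix_ge0.
rewrite esum_mkcond [RHS]esum_mkcond; apply: eq_esum => j _.
rewrite /Pi /embedding_chain -EFinM.
have [Hj|Hj] := pselect (H j).
  rewrite memNset; last by move=> /(_ Hj).
  by case: ifP => // _; rewrite wH// !mulr0.
rewrite mem_set//; have [->|ji] := eqVneq j i.
  by rewrite mul0r memNset//= eqxx.
by rewrite mem_set//= mulrA (mulrC (Q i j)).
Qed.

Lemma esum_rates_const i (c : R) : 0 <= c ->
  (\esum_(j in [set j | j != i]) (Q i j * c)%:E = (q i * c)%:E)%E.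
Proof.
move=> c0; under eq_esum => j ji do rewrite mulrC EFinM.
rewrite ge0_esumZl// ?Q_matrix.2 -?EFinM 1?mulrC// => j ji.
by rewrite lee_fin Qmatrix_ge0.
Qed.

Lemma esum_rates_add_const i w (b c : R) : 0 <= c -> (forall j, 0 <= w j) ->
  (\esum_(j in [set j | j != i]) (Q i j * w j)%:E <= b%:E)%E ->
  (\esum_(j in [set j | j != i]) (Q i j * (w j + c))%:E <= (b + q i * c)%:E)%E.
Proof.
move=> c0 w0 wb; under eq_esum => j ji do rewrite mulrDr EFinD.
rewrite esumD => [|j ji|j ji]; last 2 first.
- by rewrite lee_fin mulr_ge0 ?Qmatrix_ge0.
- by rewrite lee_fin mulr_ge0 ?Qmatrix_ge0.
by rewrite esum_rates_const// EFinD leeD2r.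
Qed.

(** A discrete form of Dynkin's formula: the hypothesis says Qw <= 1, so the mean of [w] grows by at
    most the elapsed time. *)
Lemma steps_bounded_drift w L : all (fun h => 0 <= h) L -> (forall i, 0 <= w i) ->
  (forall i, \esum_(j in [set j | j != i]) (Q i j * w j)%:E <=
    (q i * w i + 1)%:E)%E ->
  forall i, (steps Q L (EFin \o w) i <= (w i + \sum_(h <- L) h)%:E)%E.
Proof.
move=> + w0 Qw; elim: L => [_ i|h L IH /= /andP[h0 L0] i].
  by rewrite big_nil addr0.
set c := \sum_(h <- L) h in IH.
have c0 : 0 <= c by exact: (@subdivision_ge0 _ _ L).
apply: le_trans (le_step Q_matrix h0 (IH L0) i) _.
apply: (@le_trans _ _ (step Q h (EFin \o (fun j => w j + c)) i)).
  exact: le_step.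
apply: le_trans (step_le_drift Q_matrix h0 _
  (esum_rates_add_const c0 w0 (Qw i))) _ => [j|]; first by rewrite addr_ge0.
rewrite lee_fin big_cons -/c /stay -/q.
have q0 : 0 <= q i := exit_rate_ge0 Q_matrix i.
have hq : 0 <= h * q i by rewrite mulr_ge0.
have hqw : 0 <= (h * q i) ^+ 2 * (w i + c) by rewrite mulr_ge0 ?sqr_ge0 ?addr_ge0.
have hqh : 0 <= (h * q i) * h by rewrite mulr_ge0.
by case: (leP 0 (1 - h * q i)) => hq1; have := w0 i; nra.
Qed.

Lemma subsolution_uniformly_bounded : strongly_ergodic P ->
  exists B : R, forall y, bounded_above_subsolution Q H y ->
    forall i, ~ H i -> y i <= B.
Proof.
move=> [pi [pi0 pi1 pi_st] /fine_cvgP[fin]]; have [j0 Hj0] := H_nonempty.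
have pi_j0 : 0 < pi j0.
  have [i pii] : exists i, 0 < pi i.
    apply: contrapT => /forallNP npi; have : (0 = 1 :> \bar R)%E.
      rewrite -pi1 esum1// => i _; congr (_%:E); apply/eqP.
      by rewrite eq_le pi0 andbT leNgt; apply/negP.
    by move/eqP; rewrite eqe eq_sym oner_eq0.
  rewrite -lte_fin -(pi_st 1)//.
  apply: (@lt_le_trans _ _ (pi i * P 1 i j0)%:E).
    by rewrite lte_fin mulr_gt0// transition_gt0.
  apply: (@esum_ge1 _ _ _ (fun i => (pi i * P 1 i j0)%:E)) => // k _.
  by rewrite lee_fin mulr_ge0// (tf_ge0 P_tf).
have pi2 : 0 < pi j0 / 2 by rewrite divr_gt0.
move=> /cvgrPdist_le/(_ _ pi2) close.
pose d t := ereal_sup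
  [set (\esum_(j in [set: E]) `|P t i j - pi j|%:E)%E | i in [set: E]].
(* At this time all laws are so close to [pi] that each gives [j0] at least half of [pi j0]. *)
have [t [fin_t close_t t0]] : exists t,
    [/\ d t \is a fin_num, `|0 - fine (d t)| <= pi j0 / 2 & 0 <= t].
  apply: (@filter_ex _ (+oo : set_system R)); near=> t; split.
  - by near: t.
  - by near: t.
  - by near: t; apply: nbhs_pinfty_ge; exact: num_real.
pose e := pi j0 / 2.
have Pe i : e <= P t i j0.
  have : (`|P t i j0 - pi j0|%:E <= d t)%E.
    apply: (@le_trans _ _ (\esum_(j in [set: E]) `|P t i j - pi j|%:E)%E).
      by apply: (@esum_ge1 _ _ _ (fun j => `|P t i j - pi j|%:E)) => // k _;
  rewrite lee_fin.
    by apply: ereal_sup_ubound; exists i.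
  rewrite -(fineK fin_t) lee_fin => le1.
  have := le_trans le1 (le_trans (ler_norm _) _).
  move: close_t; rewrite sub0r normrN => + /(_ _) => /[swap] /[apply].
  by rewrite ler_norml => /andP[+ _]; rewrite /e; lra.
(* The solution S of S = t + (1 - e) S; [t] and [e] are fixed before [y]. *)
exists (t / e) => y [/sup_outside_bounded[b b0 yb] sub].
pose z i := if i \in H then 0 else Num.max (y i) 0.
have zH i : H i -> z i = 0 by move=> Hi; rewrite /z mem_set.
have zy i : ~ H i -> z i = Num.max (y i) 0.
  by move=> Hi; rewrite /z memNset.
have z0 i : 0 <= z i.
  by rewrite /z; case: ifP => // _; rewrite le_max lexx orbT.
have zb i : z i <= b.
  have [Hi|Hi] := pselect (H i); first by rewrite zH.
  by rewrite zy// ge_max b0 yb.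
(* Off [H], the inequality holds for [y], whose terms only grow when replaced by positive parts, and
   trivially for 0; on [H] the left side vanishes. *)
have Qz i : ((q i * z i)%:E <=
    \esum_(j in [set j | j != i]) (Q i j * z j)%:E + 1)%E.
  have Qz0 : (0 <= \esum_(j in [set j | j != i]) (Q i j * z j)%:E)%E.
    by apply: esum_ge0 => j ji; rewrite lee_fin mulr_ge0// Qmatrix_ge0.
  have [Hi|Hi] := pselect (H i); first by rewrite zH// mulr0 adde_ge0.
  have qi := exit_rate_gt0 Hi.
  have y_le : ((y i)%:E <= (q i)^-1%:E *
      (\esum_(j in [set j | j != i]) (Q i j * z j)%:E + 1))%E.
    rewrite ge0_muleDr// mule1 -esum_embedding_chain//.
    apply: le_trans (sub i Hi) _; rewrite leeD2r// /signed_esum.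
    apply: le_trans (_ : _ <= \esum_(j in ~` H) (Num.max (Pi i j * y j) 0)%:E)%E _.
      rewrite geeDl// oppe_le0 esum_ge0// => j _.
      by rewrite lee_fin le_max lexx orbT.
    apply: le_esum => j Hj; rewrite lee_fin zy// maxr_pMr ?mulr0//.
    rewrite /Pi /embedding_chain; case: eqVneq => // ji.
    by rewrite divr_ge0 ?Qmatrix_ge0// ltW.
  rewrite zy// EFinM -lee_pdivlMl// EFin_max ge_max y_le /=.
  by rewrite mule_ge0 ?adde_ge0// lee_fin invr_ge0 ltW.
(* Kernel products approach [P] from below, so only upper bounds on averages of non-negative
   functions pass to [P]; the reflection turns Qz >= -1 into Qw <= 1. *)
pose w i := b - z i.
have w0 i : 0 <= w i by rewrite subr_ge0.
have Qw i : (\esum_(j in [set j | j != i]) (Q i j * w j)%:E <=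
    (q i * w i + 1)%:E)%E.
  have split_b : (\esum_(j in [set j | j != i]) (Q i j * w j)%:E +
      \esum_(j in [set j | j != i]) (Q i j * z j)%:E = (q i * b)%:E)%E.
    rewrite -esum_rates_const// -esumD => [|j ji|j ji]; last 2 first.
    - by rewrite lee_fin mulr_ge0 ?Qmatrix_ge0.
    - by rewrite lee_fin mulr_ge0 ?Qmatrix_ge0.
    by apply: eq_esum => j _; rewrite -EFinD -mulrDr subrK.
  have := Qz i; have Qw0 : (0 <= \esum_(j in [set j | j != i]) (Q i j * w j)%:E)%E.
    by apply: esum_ge0 => j ji; rewrite lee_fin mulr_ge0 ?Qmatrix_ge0.
  have Qz0 : (0 <= \esum_(j in [set j | j != i]) (Q i j * z j)%:E)%E.
    by apply: esum_ge0 => j ji; rewrite lee_fin mulr_ge0 ?Qmatrix_ge0.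
  move: split_b Qw0 Qz0.
  case: (\esum_(j in _) (Q i j * w j)%:E)%E => [x| |]//;
  case: (\esum_(j in _) (Q i j * z j)%:E)%E => [x'| |]//.
  rewrite -!EFinD => -[xx'] _ _; rewrite !lee_fin /w; nra.
have drift i : z i <= t + (sup (range z) - P t i j0 * sup (range z)).
  have zS k : 0 <= z k <= sup (range z).
    by rewrite z0; apply: ub_le_sup; [exists b => _ [k' _ <-]|exists k].
  have Pz := average_le P_tf P_mass i j0 t0 zS; rewrite (zH j0)// subr0 in Pz.
  have Pw : (\esum_(j in [set: E]) (P t i j * w j)%:E <= (w i + t)%:E)%E.
    apply: esum_transition_le => // L tL; rewrite -tL.2.
    by apply: steps_bounded_drift => //; exact: tL.1.
  (* Conservation of mass turns the bound on the average of [w] back into z <= t + P_t z. *)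
  have Pb : (b%:E <= \esum_(j in [set: E]) (P t i j * w j)%:E +
      \esum_(j in [set: E]) (P t i j * z j)%:E)%E.
    rewrite -esumD => [|j _|j _]; last 2 first.
    - by rewrite lee_fin mulr_ge0// (tf_ge0 P_tf).
    - by rewrite lee_fin mulr_ge0// (tf_ge0 P_tf).
    have -> : (b%:E = b%:E * \esum_(j in [set: E]) (P t i j)%:E)%E.
      by rewrite P_mass// mule1.
    rewrite -ge0_esumZl// => [|j _]; last by rewrite lee_fin (tf_ge0 P_tf).
    by apply: le_esum => j _; rewrite -EFinD -EFinM lee_fin /w; nra.
  have := le_trans Pb (leeD Pw Pz); rewrite -EFinD lee_fin /w; lra.
have S0 : 0 <= sup (range z).
  apply: le_trans (z0 j0) _; apply: ub_le_sup; last by exists j0.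
  by exists b => _ [k _ <-].
have S_le : sup (range z) <= t / e.
  rewrite ler_pdivlMr//.
  suff : sup (range z) <= t + (sup (range z) - e * sup (range z)) by lra.
  apply: ge_sup => [|_ [i _ <-]]; first by exists (z j0), j0.
  by apply: le_trans (drift i) _; rewrite lerD2l lerD2l lerN2 ler_wpM2r.
move=> i Hi; apply: le_trans S_le; apply: (@le_trans _ _ (z i)).
  by rewrite zy// le_max lexx.
by apply: ub_le_sup; [exists b => _ [k _ <-]|exists i].
Unshelve. all: by end_near. Qed.

(** * Doeblin's condition from a bounded hitting-time function *)

Lemma transition_to_point_ge (T : R) j : 1 <= T ->
  exists2 d : R, 0 < d & forall i t, H i -> 1 <= t <= T -> d <= P t i j.
Proof.
move=> T1; have T10 : 0 <= T - 1 by rewrite subr_ge0.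
have [c c0 cP] := transition_diag_ge j T10.
have [|d d0 dP] := @finite_pos_lower_bound _ _ H (fun i => P 1 i j) H_finite.
  by move=> i _; exact: transition_gt0.
(* [j] is reached at time 1, uniformly over the finite set [H]; the remaining time, at most [T - 1],
   leads from [j] to [j]. *)
exists (d * c) => [|i t Hi /andP[t1 tT]]; first exact: mulr_gt0.
have t10 : 0 <= t - 1 by rewrite subr_ge0.
have := transition_mul_le i j j ler01 t10; rewrite subrKC; apply: le_trans.
apply: ler_pM; [exact: ltW|exact: ltW|exact: dP|apply: cP].
by rewrite t10 lerD2r.
Qed.

Lemma step_le_transition h w i : 0 <= h -> (forall j, 0 <= w j) ->
  (step Q h (EFin \o w) i <= \esum_(k in [set: E]) (P h i k * w k)%:E)%E.
Proof.
move=> h0 w0; have hh := subdivision1 h0.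
have /= -> := steps_matrix Q_matrix i hh.1 w0.
apply: le_esum => k _; rewrite EFinM lee_wpmul2r ?lee_fin//.
exact: (steps_le_transition i k hh).
Qed.

Section bounded_hitting_time.
Context (m : E -> R) (M : R).
Context (m_ge0 : forall i, 0 <= m i) (m_le : forall i, m i <= M).
Context (m_H : forall i, H i -> m i = 0).
Context (m_drift : forall i, ~ H i ->
  (\esum_(j in [set j | j != i]) (Q i j * m j)%:E <= (q i * m i - 1)%:E)%E).

(* Adding the elapsed time s to m gives a space-time supersolution off H. *)
Lemma step_hitting_time (C s h : R) i : 0 <= s -> 0 <= h ->
  (H i -> q i * M <= C) ->
  (step Q h (EFin \o (fun j => m j + (s + h))%R) i <=
   (m i + s + (if i \in H then h * (1 + C) else 0))%:E)%E.
Proof.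
move=> s0 h0 qC; have sh0 : 0 <= s + h by rewrite addr_ge0.
have msh0 j : 0 <= m j + (s + h) by rewrite addr_ge0.
have q0 : 0 <= q i := exit_rate_ge0 Q_matrix i.
have hq : 0 <= h * q i by rewrite mulr_ge0.
have [Hi|Hi] := pselect (H i).
  (* On [H] no drift condition is available, so [m] is bounded by [M]. *)
  have QM : (\esum_(j in [set j | j != i]) (Q i j * m j)%:E <= (q i * M)%:E)%E.
    rewrite -esum_rates_const ?(le_trans (m_ge0 i))//.
    by apply: le_esum => j ji; rewrite lee_fin ler_wpM2l// Qmatrix_ge0.
  have M0 : 0 <= M := le_trans (m_ge0 i) (m_le i).
  apply: le_trans (step_le_drift Q_matrix h0 msh0
    (esum_rates_add_const sh0 m_ge0 QM)) _.
  rewrite mem_set// m_H// lee_fin /stay -/q.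
  have {}qC := qC Hi; have qM0 : 0 <= q i * M by rewrite mulr_ge0.
  have hqM : h * (q i * M) <= h * C by rewrite ler_wpM2l.
  have hqM0 : 0 <= h * (q i * M) by rewrite mulr_ge0.
  have x1 : 0 <= (h * q i) ^+ 2 * (s + h) by rewrite mulr_ge0// sqr_ge0.
  have x2 : 0 <= (h * q i) * (h * (q i * M)) by rewrite mulr_ge0.
  by case: (leP 0 (1 - h * q i)) => hq1; nra.
apply: le_trans (step_le_drift Q_matrix h0 msh0
  (esum_rates_add_const sh0 m_ge0 (m_drift Hi))) _.
(* Hence [h <= h * q i * m i], which pays for the terms of second order in [h]. *)
have qm1 : 1 <= q i * m i.
  rewrite -subr_ge0 -lee_fin; apply: le_trans (m_drift Hi); apply: esum_ge0.
  by move=> j ji; rewrite lee_fin mulr_ge0// Qmatrix_ge0.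
rewrite memNset// addr0 lee_fin /stay -/q.
have x1 : 0 <= (h * q i) * h * (q i * m i - 1) by rewrite !mulr_ge0// subr_ge0.
have x2 : 0 <= (h * q i) ^+ 2 * s by rewrite mulr_ge0// sqr_ge0.
have x3 : 0 <= (h * q i) ^+ 2 * h by rewrite mulr_ge0// sqr_ge0.
have mi0 := m_ge0 i.
by case: (leP 0 (1 - h * q i)) => hq1; nra.
Qed.

(** The excess over a supersolution comes from the time spent in [H]. As [u] exceeds the total time
    by at least 1, a visit to [H] leads to [j0] at time [u] with probability at least [d], so
    [P u i j0] pays for that excess. *)
Lemma steps_hitting_time (C T d : R) j0 L s u i : 0 < d -> 0 <= C ->
  (forall k, H k -> q k * M <= C) ->
  (forall k t, H k -> 1 <= t <= T + 1 -> d <= P t k j0) ->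
  all (fun h => 0 <= h) L -> 0 <= s ->
  \sum_(h <- L) h + 1 <= u <= T + 1 ->
  (steps Q L (fun j => (m j + (s + \sum_(h <- L) h)%R)%:E) i <=
   (m i + s + (1 + C) / d * (\sum_(h <- L) h) * P u i j0)%:E)%E.
Proof.
move=> d0 C0 qC dP; elim: L s u i => [|h L IH] s u i.
  by move=> _ _ _; rewrite !big_nil /= !addr0 mulr0 mul0r addr0.
move=> /= /andP[h0 L0] s0; rewrite big_cons.
set c := \sum_(h <- L) h in IH * => /andP[cu uT].
have c0 : 0 <= c by exact: (@subdivision_ge0 _ c L).
have K0 : 0 <= (1 + C) / d by rewrite divr_ge0 ?addr_ge0 ?(ltW d0).
set K := (1 + C) / d in IH K0 *.
have sh0 : 0 <= s + h by rewrite addr_ge0.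
have uh0 : 0 <= u - h by lra.
have u0 : 0 <= u by lra.
have Pu0 k : 0 <= P (u - h) k j0 by exact: (tf_ge0 P_tf).
have IHu k : (steps Q L (fun j => (m j + (s + (h + c))%R)%:E) k <=
    (m k + (s + h)%R)%:E + (K * c)%:E * (P (u - h) k j0)%:E)%E.
  rewrite addrA -EFinM -EFinD; apply: IH => //.
  by apply/andP; split; lra.
apply: le_trans (le_step Q_matrix h0 IHu i) _.
have Kc0 : 0 <= K * c by rewrite mulr_ge0.
rewrite (stepZ_add Q_matrix h0 Kc0); last 2 first.
- by move=> k; rewrite lee_fin addr_ge0.
- by move=> k; rewrite lee_fin.
have step_P : (step Q h (fun k => (P (u - h) k j0)%:E) i <= (P u i j0)%:E)%E.
  apply: le_trans (step_le_transition i h0 Pu0) _.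
  by rewrite -(tf_chapman_kolmogorov P_tf)// subrKC.
apply: le_trans (leeD (step_hitting_time s0 h0 (qC i))
  (lee_wpmul2l _ step_P)) _; first by rewrite lee_fin.
rewrite -EFinM -EFinD lee_fin (mulrDr K) (mulrDl (K * h)) addrA lerD2r lerD2l.
case: ifPn => [/set_mem Hi|_]; last first.
  by apply: mulr_ge0; [exact: mulr_ge0|exact: (tf_ge0 P_tf)].
rewrite (mulrC K) -mulrA ler_wpM2l//.
rewrite /K mulrAC ler_pdivlMr// ler_wpM2l ?addr_ge0//.
by apply: dP => //; apply/andP; split; lra.
Qed.

(** [m] plays the role of the mean hitting time of [H]. The function m + t starts at or below [M]
    and is at least [M + 1] at time [M + 1]; the gain of 1 must come from time spent in [H], which
    bounds [P (M + 1 + 1) i j0] from below. *)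
Lemma hitting_time_doeblin j0 : exists t0 e : R,
  [/\ 0 < t0, 0 < e & forall i, e <= P t0 i j0].
Proof.
have M0 : 0 <= M := le_trans (m_ge0 j0) (m_le j0).
have T0 : 0 < M + 1 by lra.
have [|d d0 dP] := @transition_to_point_ge (M + 1 + 1) j0; first by lra.
have [C C0 qC] : exists2 C : R, 0 <= C & forall k, H k -> q k * M <= C.
  have /finite_seqP[s Hs] := H_finite.
  have qM0 k : 0 <= q k * M by rewrite mulr_ge0// exit_rate_ge0.
  exists (\sum_(k <- s) q k * M) => [|k]; first exact: sumr_ge0.
  by rewrite Hs /= => ks; rewrite (big_rem k ks)/= lerDl sumr_ge0.
pose K := (1 + C) / d; have K0 : 0 < K by rewrite divr_gt0// ltr_pwDl.
have T20 : 0 <= M + 1 + 1 by lra.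
exists (M + 1 + 1), (K * (M + 1))^-1; split.
- by lra.
- by rewrite invr_gt0 mulr_gt0.
- move=> i.
  have : (\esum_(j in [set: E]) (P (M + 1) i j * (M + 1))%:E <=
      (M + K * (M + 1) * P (M + 1 + 1) i j0)%:E)%E.
    apply: (esum_transition_le (ltW T0)).
      by move=> j; exact: ltW.
    move=> L [L0 LM].
    apply: (@le_trans _ _ (steps Q L (fun j => (m j + (0 + \sum_(h <- L) h)%R)%:E) i)).
      by apply: le_steps => // j; rewrite /= lee_fin LM add0r lerDr//.
    apply: le_trans (steps_hitting_time (u := M + 1 + 1) (T := M + 1) i
      d0 C0 qC dP L0 (lexx 0) _) _.
      by rewrite LM lexx.
    by rewrite LM addr0 lee_fin -/K lerD2r.
  under eq_esum => j _ do rewrite mulrC EFinM.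
  rewrite ge0_esumZl ?(ltW T0)// => [|j _]; last first.
    by rewrite lee_fin (tf_ge0 P_tf)// ltW.
  rewrite P_mass ?(ltW T0)// mule1 lee_fin => le1.
  rewrite -[leLHS]mul1r ler_pdivrMr ?(mulr_gt0 K0 T0)//.
  by rewrite mulrC; lra.
Qed.

End bounded_hitting_time.

(** * Truncated iterates of the equation *)

Lemma embedding_chain_ge0 i j : ~ H i -> 0 <= Pi i j.
Proof.
move=> Hi; rewrite /Pi /embedding_chain; case: eqVneq => // ji.
rewrite divr_ge0 ?Qmatrix_ge0// ltW//.
exact: exit_rate_gt0.
Qed.

(* The minimal non-negative solution of the equation is the limit of these
   bounded iterates; cutting the source term off keeps them bounded. *)
Fixpoint truncated_iterate (n : nat) (i : E) : R :=
  if n is n'.+1 then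
    if i \in H then 0
    else fine (\esum_(j in ~` H) (Pi i j * truncated_iterate n' j)%:E)%E
         + Num.min (q i)^-1 n%:R
  else 0.

Local Notation Y := truncated_iterate.

Lemma truncated_iterate_H n i : H i -> Y n i = 0.
Proof. by case: n => //= n Hi; rewrite mem_set. Qed.

(** Off [H] the embedding chain is substochastic and the source term added at stage [n.+1] is at
    most [n.+1%:R]; the resulting bound depends on [n]. *)
Lemma truncated_iterate_bounds n :
  (forall i, 0 <= Y n i) /\ exists b : R, forall i, Y n i <= b.
Proof.
elim: n => [|n [Y0 [b Yb]]]; first by split => //; exists 0.
have S0 i : ~ H i -> (0 <= \esum_(j in ~` H) (Pi i j * Y n j)%:E)%E.
  by move=> Hi; apply: esum_ge0 => j _; rewrite lee_fin mulr_ge0// embedding_chain_ge0.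
split=> [i|].
  rewrite /=; case: ifPn => // /negP iH.
  have Hi : ~ H i by move=> Hi; apply: iH; exact: mem_set.
  rewrite addr_ge0 ?fine_ge0 ?S0// le_min ler0n andbT invr_ge0 ltW//.
  exact: exit_rate_gt0.
exists (Num.max 0 b + n.+1%:R) => i; rewrite /=; case: ifPn => [_|/negP iH].
  by rewrite addr_ge0// le_max lexx.
have Hi : ~ H i by move=> Hi; apply: iH; exact: mem_set.
have qi : 0 < q i := exit_rate_gt0 Hi.
apply: lerD; last by rewrite ge_min lexx orbT.
have b0 : 0 <= Num.max 0 b by rewrite le_max lexx.
have : (\esum_(j in ~` H) (Pi i j * Y n j)%:E <= (Num.max 0 b)%:E)%E.
  rewrite esum_embedding_chain//; last first.
    exact: truncated_iterate_H.
  rewrite lee_pdivrMl// -EFinM -esum_rates_const//.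
  apply: le_esum => j ji; rewrite lee_fin ler_wpM2l ?Qmatrix_ge0//.
  by rewrite le_max Yb orbT.
have := S0 i Hi.
by case: (\esum_(j in _) _)%E => //= x _; rewrite lee_fin.
Qed.

Lemma truncated_iterate_ge0 n i : 0 <= Y n i.
Proof. exact: (truncated_iterate_bounds n).1. Qed.

(** Boundedness of [Y n] makes the sum finite, so [fine] loses nothing. *)
Lemma truncated_iterateS n i : ~ H i ->
  (Y n.+1 i)%:E = (\esum_(j in ~` H) (Pi i j * Y n j)%:E +
    (Num.min (q i)^-1 n.+1%:R)%:E)%E.
Proof.
move=> Hi /=; rewrite memNset// EFinD fineK//.
have qi : 0 < q i := exit_rate_gt0 Hi.
have [Y0 [b Yb]] := truncated_iterate_bounds n.
have b0 : 0 <= b := le_trans (Y0 i) (Yb i).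
rewrite esum_embedding_chain//; last first.
  exact: truncated_iterate_H.
rewrite fin_numM// ge0_fin_numE.
  apply: (@le_lt_trans _ _ (q i * b)%:E); last exact: ltry.
  rewrite -esum_rates_const//; apply: le_esum => j ji.
  by rewrite lee_fin ler_wpM2l ?Qmatrix_ge0.
by apply: esum_ge0 => j ji; rewrite lee_fin mulr_ge0 ?Qmatrix_ge0.
Qed.

Lemma truncated_iterate_leS n i : Y n i <= Y n.+1 i.
Proof.
elim: n i => [|n IH] i; first exact: truncated_iterate_ge0.
have [Hi|Hi] := pselect (H i); first by rewrite !truncated_iterate_H.
rewrite -lee_fin !truncated_iterateS// leeD//.
  apply: le_esum => j _; rewrite lee_fin ler_wpM2l//.
  exact: embedding_chain_ge0.
by rewrite lee_fin le_min !ge_min lexx/= orbC ler_nat leqnSn.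
Qed.

Lemma truncated_iterate_mono n p i : (n <= p)%N -> Y n i <= Y p i.
Proof.
elim: p => [|p IH]; first by rewrite leqn0 => /eqP ->.
rewrite leq_eqVlt => /predU1P[-> //|]; rewrite ltnS => /IH /le_trans; apply.
exact: truncated_iterate_leS.
Qed.

(** The recursion is an equality with [Y n.+1] on the left; monotonicity in [n] and the truncation
    of the source make it the inequality. *)
Lemma truncated_iterate_subsolution n : bounded_above_subsolution Q H (Y n).
Proof.
split.
  have [_ [b Yb]] := truncated_iterate_bounds n.
  apply: (@le_lt_trans _ _ b%:E); last exact: ltry.
  by apply: ge_ereal_sup => _ [i _ <-]; rewrite lee_fin.
move=> i Hi; rewrite /signed_esum [X in (_ - X)%E]esum1 ?sube0; last first.
  move=> j _; congr (_%:E); apply/max_idPr.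
  by rewrite oppr_le0 mulr_ge0 ?truncated_iterate_ge0// embedding_chain_ge0.
apply: le_trans (_ : _ <= (Y n.+1 i)%:E)%E _.
  by rewrite lee_fin truncated_iterate_leS.
rewrite truncated_iterateS// leeD//; last by rewrite lee_fin ge_min lexx.
by apply: le_esum => j _; rewrite lee_fin le_max lexx.
Qed.

Lemma bounded_iterates_strongly_ergodic (M : R) :
  (forall n i, Y n i <= M) -> strongly_ergodic P.
Proof.
move=> YM; pose m i := sup (range (Y ^~ i)).
have Ysup i : has_sup (range (Y ^~ i)).
  split; first by exists (Y 0 i), 0%N.
  by exists M => _ [n _ <-].
have Ym n i : Y n i <= m i by apply: sup_upper_bound => //; exists n.
have m0 i : 0 <= m i := le_trans (truncated_iterate_ge0 0 i) (Ym 0%N i).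
have mM i : m i <= M.
  by apply: ge_sup => [|_ [n _ <-]]; first by exists (Y 0 i), 0%N.
have mH i : H i -> m i = 0.
  move=> Hi; apply/eqP; rewrite eq_le m0 andbT; apply: ge_sup.
    by exists (Y 0 i), 0%N.
  by move=> _ [n _ <-]; rewrite truncated_iterate_H.
have m_drift i : ~ H i ->
    (\esum_(j in [set j | j != i]) (Q i j * m j)%:E <= (q i * m i - 1)%:E)%E.
  move=> Hi; have qi : 0 < q i := exit_rate_gt0 Hi.
  (* From this index on, the truncation is inactive at [i]. *)
  pose N := (Num.truncn (q i)^-1).+1.
  have NE (v : E -> R) : (\esum_(j in [set j | j != i]) (Q i j * v j)%:E =
      \esum_(j in [set: E]) ((if j == i then 0 else Q i j) * v j)%:E)%E.
    rewrite esum_mkcond; apply: eq_esum => j _; have [->|ji] := eqVneq j i.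
      by rewrite memNset ?mul0r//= eqxx.
    by rewrite mem_set.
  rewrite NE; apply: (@esum_le_directed _ _ _ [set n | (N <= n)%N] Y).
  - by exists N => /=.
  - by move=> j; case: eqVneq => // ji; exact: Qmatrix_ge0.
  - move=> n p /= Nn Np; exists (maxn n p); first by rewrite /= leq_max Nn.
    by move=> j; split; apply: truncated_iterate_mono; rewrite leq_max leqnn ?orbT.
  - move=> j e e0; have [_ [n _ <-] lt] := sup_adherent e0 (Ysup j).
    exists (maxn n N); first by rewrite /= leq_max leqnn orbT.
    rewrite -lerBlDr; apply: le_trans (ltW lt) _.
    by apply: truncated_iterate_mono; rewrite leq_max leqnn.
  - by move=> n j _; exact: truncated_iterate_ge0.
  - move=> n /= Nn; rewrite -NE.
    have := truncated_iterateS n Hi.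
    rewrite esum_embedding_chain//; first last.
    - exact: truncated_iterate_H.
    - exact: truncated_iterate_ge0.
    rewrite min_l; last first.
      have : (q i)^-1 <= N%:R by apply/ltW/truncnS_gt.
      by move=> /le_trans; apply; rewrite ler_nat leqW.
    have : (0 <= \esum_(j in [set j | j != i]) (Q i j * Y n j)%:E)%E.
      apply: esum_ge0 => j ji; rewrite lee_fin mulr_ge0 ?Qmatrix_ge0//.
      exact: truncated_iterate_ge0.
    case: (\esum_(j in _) _)%E => [x _|_|//].
      rewrite -EFinM -EFinD => Y_eq; have Yx := EFin_inj Y_eq; rewrite lee_fin.
      have -> : x = q i * Y n.+1 i - 1.
        by rewrite Yx mulrDr mulrA divff ?gt_eqF// mul1r addrK.
      by rewrite lerD2r ler_wpM2l// ltW.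
    (* An infinite sum would contradict the finiteness of [Y n.+1 i]. *)
    by rewrite gt0_muley ?lte_fin ?invr_gt0.
have [j0 _] := H_nonempty.
have [t0 [e [t0_gt0 e_gt0 He]]] := hitting_time_doeblin m0 mM mH m_drift j0.
exact: (doeblin_strongly_ergodic P_tf P_mass t0_gt0 e_gt0 He).
Qed.

End ergodicity.

Theorem theorem2 (R : realType) (E : countType) (Q : E -> E -> R)
    (P : R -> E -> E -> R) (H : set E)
    (Q_matrix : is_Qmatrix Q) (Q_irreducible : irreducible Q)
    (Q_regular : regular Q) (P_Qprocess : is_Qprocess Q P)
    (H_nonempty : H !=set0) (H_finite : finite_set H) :
  (~ strongly_ergodic P <->
   exists y : nat -> E -> R,
     (forall n, bounded_above_subsolution Q H (y n)) /\
     ereal_sup [set sup_outside H (y n) | n in [set: nat]] = +oo%E) /\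
  (forall y : nat -> E -> R,
     (forall n, bounded_above_subsolution Q H (y n)) ->
     (ereal_sup [set sup_outside H (y n) | n in [set: nat]] = +oo%E <->
      limn_esup (fun n => sup_outside H (y n)) = +oo%E)).
Proof.
have [P0 [_ P0_mass P0_unique]] := Q_regular.
have P_tf := P_Qprocess.1.
have P_min t i j : 0 <= t -> P t i j = min_prob Q t i j.
  (* Both [P] and the minimal process coincide with the unique process [P0]. *)
  move=> t0; rewrite (P0_unique _ P_Qprocess)//.
  by rewrite (P0_unique _ (min_prob_is_Qprocess Q_matrix)).
have P_mass : non_explosive P.
  move=> t i t0; rewrite -(P0_mass t i t0); apply: eq_esum => j _.
  by rewrite (P0_unique _ P_Qprocess).
split; last first.
  by move=> y y_sub; apply: limn_esup_pinfty => n; exact: (y_sub n).1.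
split=> [nSE|[y [y_sub y_sup]] SE].
  exists (truncated_iterate Q H); split.
    by move=> n; exact: truncated_iterate_subsolution.
  (* Were the supremum over all iterates not [+oo], they would be uniformly bounded and the process
     strongly ergodic. *)
  apply: contrapT => /eqP; rewrite -ltey => supY; apply: nSE.
  pose sY := ereal_sup
    [set sup_outside H (truncated_iterate Q H n) | n in [set: nat]].
  have Y_le n i : ~ H i -> ((truncated_iterate Q H n i)%:E <= sY)%E.
    move=> Hi; apply: (@le_trans _ _ (sup_outside H (truncated_iterate Q H n))).
      by apply: ereal_sup_ubound; exists i.
    by apply: ereal_sup_ubound; exists n.
  apply: (@bounded_iterates_strongly_ergodic _ _ Q P H _ _ _ _ _ _ _
    (Num.max 0 (fine sY))) => // n i.
  have [Hi|Hi] := pselect (H i).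
    by rewrite truncated_iterate_H// le_max lexx.
  rewrite le_max; apply/orP; right; move: (Y_le n i Hi); rewrite -/sY in supY.
  by case: sY supY {Y_le} => [r| |]; rewrite ?lee_fin ?leeNy_eq.
have [B y_le] := subsolution_uniformly_bounded Q_matrix Q_irreducible P_tf
  P_mass P_min H_nonempty SE.
suff : (+oo <= B%:E)%E by rewrite leye_eq.
rewrite -y_sup; apply: ge_ereal_sup => _ [n _ <-].
by apply: ge_ereal_sup => _ [i Hi <-]; rewrite lee_fin; exact: y_le.
Qed.
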